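(* Let $L$ be a finite-dimensional solvable restricted Lie algebra over a field $\mathbb{F}$ of prime characteristic. If $S$ is an irreducible restricted $L$-module, then $$[\operatorname{Jac}(u(L))P_L(\mathbb{F})/\operatorname{Jac}(u(L))^2P_L(\mathbb{F}):S]=\begin{cases}[L:S]_{\rm split} & \text{if } S\not\cong\mathbb{F},\\ [L:S]_{\rm split}-\dim_{\mathbb{F}}\bigl(\langle L^{[p]}\rangle_{\mathbb{F}}\big/\bigl([L,L]\cap\langle L^{[p]}\rangle_{\mathbb{F}}\bigr)\bigr) & \text{if } S\cong\mathbb{F}.\end{cases}$$
   Context: For a finite-dimensional restricted Lie algebra $L$ (with $p$-map $x\mapsto x^{[p]}$) over $\mathbb{F}$, $u(L)$ denotes its restricted universal enveloping algebra, a finite-dimensional unital associative algebra whose modules are exactly the restricted $L$-modules. $\operatorname{Jac}(A)$ denotes the Jacobson radical of a finite-dimensional associative algebra $A$. $P_L(\mathbb{F}):=P_{u(L)}(\mathbb{F})$ denotes the projective cover of the trivial irreducible $L$-module $\mathbb{F}$ as a $u(L)$-module. $[M:S]$ denotes the multiplicity of $S$ as a composition factor of $M$. $L^{[p]}:=\{x^{[p]}\mid x\in L\}$, and $\langle X\rangle_{\mathbb{F}}$ denotes the $\mathbb{F}$-subspace of $L$ spanned by a subset $X$ of $L$. A chief series of a finite-dimensional Lie algebra $L$ is an ascending chain $0=L_0\subset L_1\subset\cdots\subset L_n=L$ of (ordinary) ideals of $L$ such that $L_j/L_{j-1}$ is a minimal (non-zero) ideal of $L/L_{j-1}$ for every $1\le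 j\le n$; each $L_j/L_{j-1}$ is called a chief factor, and it is an $L$-module via the adjoint action. It is called an abelian chief factor if it is an abelian Lie algebra. For a finite-dimensional irreducible $L$-module $S$ and a given chief series of $L$, $[L:S]_{\rm split}$ denotes the number of indices $j$ such that $L_j/L_{j-1}$ is an abelian chief factor isomorphic to $S$ as an $L$-module and the exact sequence $0\to L_j/L_{j-1}\to L/L_{j-1}\to L/L_j\to 0$ splits in the category of (ordinary) Lie algebras. This number does not depend on the choice of the chief series. *)

(* Defs.v *)
From HB Require Import structures.
From mathcomp Require Import all_boot all_order all_algebra all_field.
From mathcomp Require Import boolp classical_sets.

Set Implicit Arguments.
Unset Strict Implicit.
Unset Printing Implicit Defensive.

Import GRing.Theory.
Local Open Scope ring_scope.

Section SpanQuotient.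
Variables (F : fieldType) (V : vectType F).

Lemma bigcapv_exists (P : {vspace V} -> Prop) :
  exists W : {vspace V}, forall x, x \in W <-> (forall U, P U -> x \in U).
Proof.
pose Q (W : {vspace V}) := forall x, (forall U, P U -> x \in U) -> x \in W.
pose d n := `[< exists W, Q W /\ \dim W = n >].
have exd : exists n, d n.
  by exists (\dim {:V}); apply/asboolP; exists fullv; split=> // x _; rewrite memvf.
case: (ex_minnP exd) => n /asboolP[W [QW dW]] minn.
exists W => x; split; last exact: QW.
move=> xW U PU; suff /subvP/(_ x xW) : (W <= W :&: U)%VS.
  by rewrite memv_cap => /andP[].
rewrite -(geq_leqif (dimv_leqif_sup (capvSl W U))) dW; apply: minn.
apply/asboolP; exists (W :&: U)%VS; split=> // y hy.
by rewrite memv_cap QW // hy.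
Qed.

(* The intersection of a possibly infinite family of subspaces. *)
Definition bigcapv (P : {vspace V} -> Prop) : {vspace V} :=
  projT1 (cid (bigcapv_exists P)).

Lemma bigcapvP (P : {vspace V} -> Prop) x :
  x \in bigcapv P <-> (forall U, P U -> x \in U).
Proof. by rewrite /bigcapv; case: cid. Qed.

(* The span of an arbitrary, possibly infinite, set of vectors; the library
   only provides the span of a finite sequence. *)
Definition spanv (X : set V) : {vspace V} :=
  bigcapv (fun W => forall x, X x -> x \in W).

Lemma mem_spanv (X : set V) x : X x -> x \in spanv X.
Proof. by move=> Xx; apply/bigcapvP => W; apply. Qed.

Lemma spanv_sub (X : set V) (W : {vspace V}) :
  (forall x, X x -> x \in W) -> (spanv X <= W)%VS.
Proof. by move=> XW; apply/subvP => x /bigcapvP; apply. Qed.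

(* The quotient space V / W, modelled on the complement of W chosen by the
   library; quotv_proj is the canonical projection and quotv_repr picks a
   representative of a coset. *)
Definition quotv (W : {vspace V}) : vectType F := subvs_of (W^C)%VS.

Definition quotv_proj (W : {vspace V}) : 'Hom(V, quotv W) :=
  (linfun (vsproj (W^C)) \o daddv_pi (W^C) W)%VF.

Definition quotv_repr (W : {vspace V}) : 'Hom(quotv W, V) :=
  linfun (vsval : quotv W -> V).

Lemma quotv_reprK (W : {vspace V}) : cancel (quotv_repr W) (quotv_proj W).
Proof.
move=> u; rewrite /quotv_proj /quotv_repr comp_lfunE !lfunE /=.
rewrite daddv_pi_id ?subvsP ?vsvalK //.
by rewrite capvC capv_compl.
Qed.

Lemma quotv_proj_eq0 (W : {vspace V}) x : (quotv_proj W x == 0) = (x \in W).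
Proof.
rewrite /quotv_proj comp_lfunE lfunE /=.
have cW : (W^C :&: W = 0)%VS by rewrite capvC capv_compl.
have eqx : daddv_pi (W^C) W x + daddv_pi W (W^C) x = x.
  by apply: daddv_pi_add => //; rewrite addvC addv_complf memvf.
apply/eqP/idP => [h|xW].
  rewrite -eqx -(vsprojK (memv_pi _ _ x)) h raddf0 add0r.
  exact: memv_pi.
suff -> : daddv_pi (W^C) W x = 0 by rewrite raddf0.
apply/eqP; rewrite -memv0 -cW memv_cap memv_pi /=.
by rewrite -[X in X \in _](addrK (daddv_pi W (W^C) x)) eqx memvB // memv_pi.
Qed.

Lemma quotv_proj_eq (W : {vspace V}) x y :
  (quotv_proj W x == quotv_proj W y) = (x - y \in W).
Proof. by rewrite -quotv_proj_eq0 raddfB subr_eq0. Qed.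

Lemma quotv_projK (W : {vspace V}) x :
  quotv_repr W (quotv_proj W x) - x \in W.
Proof. by rewrite -quotv_proj_eq quotv_reprK. Qed.

(* The canonical map V / W1 -> V / W2 when W1 is contained in W2. *)
Definition quotv_map (W1 W2 : {vspace V}) : 'Hom(quotv W1, quotv W2) :=
  (quotv_proj W2 \o quotv_repr W1)%VF.

End SpanQuotient.

Section SubQuotient.
Variables (F : fieldType) (V : vectType F).

(* The intersection of X with Y, as a subspace of Y. *)
Definition insubv (X Y : {vspace V}) : {vspace subvs_of Y} :=
  (linfun (vsval : subvs_of Y -> V) @^-1: X)%VS.

Lemma mem_insubv (X Y : {vspace V}) (u : subvs_of Y) :
  (u \in insubv X Y) = (vsval u \in X).
Proof. by rewrite /insubv -memv_preim lfunE. Qed.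

(* Y / X, for a subspace X of Y. *)
Definition subquotv (X Y : {vspace V}) : vectType F := quotv (insubv X Y).

End SubQuotient.

(* Being vectTypes, all the algebras and modules below are finite-dimensional. *)
Record lieAlgebra (F : fieldType) := LieAlgebra {
  lie_car :> vectType F;
  br : lie_car -> lie_car -> lie_car;
  br_linl : forall y, linear (br^~ y);
  br_linr : forall x, linear (br x);
  brxx : forall x, br x x = 0;
  br_jacobi : forall x y z, br x (br y z) + br y (br z x) + br z (br x y) = 0
}.

HB.instance Definition _ (F : fieldType) (L : lieAlgebra F) (x : L) :=
  GRing.isLinear.Build F L L *:%R (br x) (br_linr x).

Record lieModule (F : fieldType) (L : lieAlgebra F) := LieModule {
  lm_car :> vectType F;
  lact : L -> lm_car -> lm_car;
  lact_linl : forall m, linear (lact^~ m);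
  lact_linr : forall x, linear (lact x);
  lact_br : forall x y m, lact (br x y) m = lact x (lact y m) - lact y (lact x m)
}.

HB.instance Definition _ (F : fieldType) (L : lieAlgebra F) (M : lieModule L) (x : L) :=
  GRing.isLinear.Build F M M *:%R (@lact F L M x) (lact_linr x).

Record lieSubmodule (F : fieldType) (L : lieAlgebra F) (M : lieModule L) :=
  LieSubmodule {
  ls_car :> {vspace M};
  ls_stable : forall x m, m \in ls_car -> lact x m \in ls_car
}.

Section LieModules.
Variables (F : fieldType) (L : lieAlgebra F).
Implicit Types M N S : lieModule L.

Definition lie_iso M N : Prop :=
  exists2 f : 'Hom(M, N), bijective f & forall x m, f (lact x m) = lact x (f m).

Definition lie_irreducible M : Prop :=
  \dim {:M} != 0%N /\
  forall N : lieSubmodule M, (N : {vspace M}) = 0%VS \/ (N : {vspace M}) = fullv.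

Lemma br_anti (x y : L) : br x y = - br y x.
Proof.
have Dl z u v : br (u + v) z = br u z + br v z :> L.
  by have := br_linl z 1 u v; rewrite !scale1r.
have := brxx (x + y); rewrite linearD /= !Dl !brxx add0r addr0 => /eqP.
by rewrite addrC addr_eq0 => /eqP.
Qed.

Lemma triv_br (x y : L) (m : F^o) : (0 : F^o) = 0 - 0.
Proof. by rewrite subr0. Qed.

Lemma triv_lin (V : vectType F) : linear (fun _ : V => 0 : F^o).
Proof. by move=> a u v; rewrite scaler0 addr0. Qed.

Definition triv_mod : lieModule L :=
  @LieModule F L F^o (fun _ _ => 0) (fun _ => triv_lin (V := L))
    (fun _ => triv_lin (V := F^o)) triv_br.

Lemma adj_br (x y z : L) : br (br x y) z = br x (br y z) - br y (br x z).
Proof.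
have := br_jacobi x y z; rewrite (br_anti z x) (br_anti z (br x y)) linearN.
by move/eqP; rewrite subr_eq0 => /eqP.
Qed.

Definition adj_mod : lieModule L :=
  LieModule (br_linl (l := L)) (br_linr (l := L)) adj_br.

Section SubQuot.
Variable M : lieModule L.

Section Sub.
Variable N : lieSubmodule M.

Definition sub_act (x : L) (u : subvs_of N) : subvs_of N :=
  Subvs (ls_stable x (subvsP u)).

Lemma sub_act_linl u : linear (sub_act^~ u).
Proof. by move=> a x y; apply/val_inj; rewrite /= lact_linl. Qed.

Lemma sub_act_linr x : linear (sub_act x).
Proof. by move=> a u v; apply/val_inj; rewrite /= lact_linr. Qed.

Lemma sub_act_br x y u :
  sub_act (br x y) u = sub_act x (sub_act y u) - sub_act y (sub_act x u).
Proof. by apply/val_inj; rewrite /= lact_br. Qed.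

Definition sub_mod : lieModule L := LieModule sub_act_linl sub_act_linr sub_act_br.

Definition quot_act (x : L) (u : quotv N) : quotv N :=
  quotv_proj N (lact x (quotv_repr N u)).

Lemma quot_actE x m : quot_act x (quotv_proj N m) = quotv_proj N (lact x m).
Proof.
by apply/eqP; rewrite quotv_proj_eq -linearB ls_stable // quotv_projK.
Qed.

Lemma quot_act_linl u : linear (quot_act^~ u).
Proof. by move=> a x y; rewrite /quot_act lact_linl linearP. Qed.

Lemma quot_act_linr x : linear (quot_act x).
Proof. by move=> a u v; rewrite /quot_act linearP lact_linr linearP. Qed.

Lemma quot_act_br x y u :
  quot_act (br x y) u = quot_act x (quot_act y u) - quot_act y (quot_act x u).
Proof.
by rewrite -[u](quotv_reprK (W := N)) !quot_actE lact_br raddfB.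
Qed.

Definition quot_mod : lieModule L :=
  LieModule quot_act_linl quot_act_linr quot_act_br.

End Sub.

End SubQuot.

Lemma insubv_stable M (X Y : lieSubmodule M) (x : L) (u : sub_mod Y) :
  u \in insubv X Y -> lact x u \in insubv X Y.
Proof. by rewrite !mem_insubv => /(ls_stable x). Qed.

(* The module Y / X, for submodules X of Y of M; its carrier is subquotv X Y. *)
Definition subquot_mod M (X Y : lieSubmodule M) : lieModule L :=
  quot_mod (LieSubmodule (@insubv_stable M X Y)).

Definition composition_series M (n : nat) (N : nat -> lieSubmodule M) : Prop :=
  [/\ (N 0%N : {vspace M}) = 0%VS, (N n : {vspace M}) = fullv &
      forall i, (i < n)%N ->
        (N i <= N i.+1)%VS /\ lie_irreducible (subquot_mod (N i) (N i.+1))].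

(* [M : S], computed from a composition series of M. *)
Definition composition_mult M (n : nat) (N : nat -> lieSubmodule M) S : nat :=
  #|[set i : 'I_n | `[< lie_iso (subquot_mod (N i) (N i.+1)) S >]]|.

End LieModules.

(* An ideal of L is a submodule of the adjoint module. *)
Notation lieIdeal L := (lieSubmodule (adj_mod L)).

Section Chief.
Variables (F : fieldType) (L : lieAlgebra F).

Section Quotient.
Variable I : lieIdeal L.

Let W : {vspace L} := I.

Definition quot_br (u v : quotv W) : quotv W :=
  quotv_proj W (br (quotv_repr W u) (quotv_repr W v)).

Lemma quot_brE (x y : L) :
  quot_br (quotv_proj W x) (quotv_proj W y) = quotv_proj W (br x y).
Proof.
have hr (z : L) u v : u - v \in W -> quotv_proj W (br z u) = quotv_proj W (br z v).
  move=> uv; apply/eqP; rewrite quotv_proj_eq.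
  by rewrite -linearB; exact: (@ls_stable _ _ _ I).
rewrite /quot_br (hr _ _ y) ?quotv_projK // br_anti [in RHS]br_anti !linearN /=.
by rewrite (hr _ _ x) ?quotv_projK.
Qed.

Lemma quot_br_linl v : linear (quot_br^~ v).
Proof. by move=> a x y; rewrite /quot_br linearP br_linl linearP. Qed.

Lemma quot_br_linr u : linear (quot_br u).
Proof. by move=> a x y; rewrite /quot_br linearP br_linr linearP. Qed.

Lemma quot_brxx u : quot_br u u = 0.
Proof. by rewrite /quot_br brxx raddf0. Qed.

Lemma quot_br_jacobi u v w :
  quot_br u (quot_br v w) + quot_br v (quot_br w u) + quot_br w (quot_br u v) = 0.
Proof.
rewrite -[u](quotv_reprK (W := W)) -[v](quotv_reprK (W := W)).
by rewrite -[w](quotv_reprK (W := W)) !quot_brE -!raddfD br_jacobi raddf0.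
Qed.

Definition quot_lie : lieAlgebra F :=
  LieAlgebra quot_br_linl quot_br_linr quot_brxx quot_br_jacobi.

End Quotient.

Definition brv (U V : {vspace L}) : {vspace L} :=
  spanv [set z | exists x y, [/\ x \in U, y \in V & z = br x y]]%classic.

Definition lie_solvable : Prop :=
  exists n, iter n (fun U => brv U U) fullv = 0%VS :> {vspace L}.

Definition minimal_ideal (I : {vspace L}) : Prop :=
  [/\ exists J : lieIdeal L, I = J :> {vspace L}, I != 0%VS &
      forall J : lieIdeal L, (J <= I)%VS -> J = 0%VS :> {vspace L} \/ J = I :> {vspace L}].

Definition abelian_sub (I : {vspace L}) : Prop :=
  forall x y, x \in I -> y \in I -> br x y = 0.

End Chief.

Definition lie_hom (F : fieldType) (L L' : lieAlgebra F) (f : 'Hom(L, L')) : Prop :=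
  forall x y, f (br x y) = br (f x) (f y).

Section ChiefSeries.
Variables (F : fieldType) (L : lieAlgebra F).
Implicit Types I J : lieIdeal L.

(* J / I as a subspace of the Lie algebra L / I. *)
Definition factor_in I J : {vspace quot_lie I} := (quotv_proj I @: J)%VS.

Definition chief_series (n : nat) (I : nat -> lieIdeal L) : Prop :=
  [/\ (I 0%N : {vspace L}) = 0%VS, (I n : {vspace L}) = fullv &
      forall j, (j < n)%N ->
        (I j <= I j.+1)%VS /\ minimal_ideal (factor_in (I j) (I j.+1))].

(* 0 -> J / I -> L / I -> L / J -> 0 splits in the category of Lie algebras. *)
Definition factor_splits I J : Prop :=
  exists2 s : 'Hom(quot_lie J, quot_lie I), lie_hom s &
    cancel s (quotv_map I J).

(* [L : S]_split, computed from a chief series of L. *)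
Definition split_mult (n : nat) (I : nat -> lieIdeal L) (S : lieModule L) : nat :=
  #|[set j : 'I_n | `[< [/\ abelian_sub (factor_in (I j) (I j.+1)),
                           lie_iso (subquot_mod (I j) (I j.+1)) S &
                           factor_splits (I j) (I j.+1)] >]]|.

End ChiefSeries.

(* The coefficient of 'X^k in ad(x 'X + y)^n (x), computed in L[X], whose
   elements are represented by their sequences of coefficients. *)
Definition ad_coef (F : fieldType) (L : lieAlgebra F) (x y : L) (n : nat) : nat -> L :=
  iter n (fun c k => (if k is k'.+1 then br x (c k') else 0) + br y (c k))
       (fun k => if k == 0%N then x else 0).

(* Jacobson's s_i(x, y): i s_i(x, y) is the coefficient of 'X^(i-1) in
   ad(x 'X + y)^(p-1) (x). *)
Definition jacobson_s (F : fieldType) (L : lieAlgebra F) (p : nat) (x y : L) (i : nat) : L :=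
  (i%:R : F)^-1 *: ad_coef x y p.-1 i.-1.

Record restrictedLieAlgebra (F : fieldType) (p : nat) := RestrictedLieAlgebra {
  rl_lie :> lieAlgebra F;
  rl_pmap : rl_lie -> rl_lie;
  rl_pmapZ : forall (a : F) x, rl_pmap (a *: x) = a ^+ p *: rl_pmap x;
  rl_pmapD : forall x y,
    rl_pmap (x + y) = rl_pmap x + rl_pmap y + \sum_(1 <= i < p) jacobson_s p x y i;
  rl_pmap_ad : forall x y, br (rl_pmap x) y = iter p (br x) y
}.

Definition restricted_module (F : fieldType) (p : nat) (L : restrictedLieAlgebra F p)
    (M : lieModule L) : Prop :=
  forall x m, lact (rl_pmap x) m = iter p (lact x) m :> M.

Definition restricted_hom (F : fieldType) (p : nat) (L : restrictedLieAlgebra F p)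
    (A : algType F) (f : L -> A) : Prop :=
  [/\ linear f, forall x y, f (br x y) = f x * f y - f y * f x &
      forall x, f (rl_pmap x) = f x ^+ p].

(* u(L), characterized up to isomorphism by its universal property. *)
Record restrictedEnvelope (F : fieldType) (p : nat) (L : restrictedLieAlgebra F p) :=
  RestrictedEnvelope {
  env_alg :> falgType F;
  env_inj : L -> env_alg;
  env_hom : restricted_hom env_inj;
  env_univ : forall (A : algType F) (f : L -> A), restricted_hom f ->
    exists2 g : {lrmorphism env_alg -> A}, g \o env_inj =1 f &
      forall h : {lrmorphism env_alg -> A}, h \o env_inj =1 f -> h =1 g
}.

Record algModule (F : fieldType) (A : falgType F) := AlgModule {
  am_car :> vectType F;
  aact : A -> am_car -> am_car;
  aact_linl : forall m, linear (aact^~ m);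
  aact_linr : forall a, linear (aact a);
  aact1 : forall m, aact 1 m = m;
  aactM : forall a b m, aact (a * b) m = aact a (aact b m)
}.

HB.instance Definition _ (F : fieldType) (A : falgType F) (M : algModule A) (a : A) :=
  GRing.isLinear.Build F M M *:%R (@aact F A M a) (aact_linr a).

Section AlgModules.
Variables (F : fieldType) (A : falgType F).
Implicit Types M N P T : algModule A.

Definition alg_hom M N (f : 'Hom(M, N)) : Prop := forall a m, f (aact a m) = aact a (f m).

Definition alg_submodule M (N : {vspace M}) : Prop :=
  forall a m, m \in N -> aact a m \in N.

(* The lifting property against finite-dimensional modules: for a
   finite-dimensional P it gives that P is a direct summand of some A^n. *)
Definition projective P : Prop :=
  forall M N (g : 'Hom(M, N)) (f : 'Hom(P, N)),
    alg_hom g -> limg g = fullv -> alg_hom f ->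
    exists2 h : 'Hom(P, M), alg_hom h & (g \o h)%VF = f.

Definition superfluous M (K : {vspace M}) : Prop :=
  forall N : {vspace M}, alg_submodule N -> (K + N)%VS = fullv -> N = fullv.

Definition projective_cover P T (pi : 'Hom(P, T)) : Prop :=
  [/\ projective P, alg_hom pi, limg pi = fullv & superfluous (lker pi)].

(* Left ideals of the unital algebra A are automatically subspaces. *)
Definition left_ideal (I : {vspace A}) : Prop := forall a b, b \in I -> a * b \in I.

Definition maximal_left_ideal (I : {vspace A}) : Prop :=
  [/\ left_ideal I, I != fullv &
      forall J, left_ideal J -> (I <= J)%VS -> J = I \/ J = fullv].

Definition Jac : {vspace A} := bigcapv maximal_left_ideal.

(* I M, for a subspace I of A. *)
Definition actv M (I : {vspace A}) : {vspace M} :=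
  spanv [set z | exists a m, a \in I /\ z = aact a m]%classic.

Lemma left_ideal_Jac : left_ideal Jac.
Proof.
by move=> a b /bigcapvP hb; apply/bigcapvP => I mI; case: (mI) => lI _ _; exact/lI/hb.
Qed.

Lemma left_ideal_Jac2 : left_ideal (Jac * Jac)%VS.
Proof.
move=> a b bJ.
have /subvP/(_ _ (memv_mul (memvf a) bJ)) : ({:A} * (Jac * Jac) <= Jac * Jac)%VS.
  rewrite prodvA; apply: prodvSl; apply/prodvP => u v _; exact: left_ideal_Jac.
by [].
Qed.

Lemma alg_submodule_actv M (I : {vspace A}) : left_ideal I -> alg_submodule (actv M I).
Proof.
move=> lI a m mI.
suff : (actv M I <= linfun (@aact F A M a) @^-1: actv M I)%VS.
  by move/subvP/(_ m mI); rewrite -memv_preim lfunE.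
apply: spanv_sub => _ [b [n [bI ->]]]; rewrite -memv_preim lfunE /= -aactM.
by apply: mem_spanv; exists (a * b), n; split=> //; apply: lI.
Qed.

End AlgModules.

Section Restriction.
Variables (F : fieldType) (p : nat) (L : restrictedLieAlgebra F p).
Variable U : restrictedEnvelope L.
Variable M : algModule U.

Let act (x : L) (m : M) : M := aact (env_inj U x) m.

Lemma res_linl m : linear (act^~ m).
Proof. by move=> a x y; rewrite /act; case: (env_hom U) => -> _ _; rewrite aact_linl. Qed.

Lemma res_linr x : linear (act x).
Proof. exact: aact_linr. Qed.

Lemma res_br x y m : act (br x y) m = act x (act y m) - act y (act x m).
Proof.
rewrite /act; case: (env_hom U) => _ -> _; rewrite -!aactM.
by rewrite addrC -scaleN1r aact_linl scaleN1r addrC.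
Qed.

(* A u(L)-module, seen as a (restricted) L-module. *)
Definition res_mod : lieModule L := LieModule res_linl res_linr res_br.

Lemma res_stable (N : {vspace M}) :
  alg_submodule N -> forall x (m : res_mod), m \in N -> lact x m \in N.
Proof. by move=> hN x m; apply: hN. Qed.

Definition res_submod (N : {vspace M}) (hN : alg_submodule N) : lieSubmodule res_mod :=
  @LieSubmodule F L res_mod N (res_stable hN).

(* Jac(u(L)) M / Jac(u(L))^2 M as an L-module. *)
Definition radical_layer : lieModule L :=
  subquot_mod
    (res_submod (alg_submodule_actv (M := M) (left_ideal_Jac2 (A := U))))
    (res_submod (alg_submodule_actv (M := M) (left_ideal_Jac (A := U)))).

End Restriction.

(* Main.v *)
Require Import Defs.
From mathcomp Require Import all_boot all_order all_algebra all_field.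
From mathcomp Require Import boolp classical_sets.
From HB Require Import structures.

(** Both sides count derivations from L to S.  Write E for the division algebra
    End_L(S) and e for its dimension.

    On the left, the Loewy layer Jac P / Jac^2 P is semisimple, so that its
    homomorphisms to S form a space of dimension e times the multiplicity of S
    (dim_hom_space).  Choose m0 in P over a generator of the trivial module.
    A homomorphism f from the layer to S gives the derivation x |-> f (x m0),
    which is restricted: it satisfies d(x^{[p]}) = x^{p-1} d(x).  This is the
    usual identification of Ext^1(F, S) with the restricted derivations modulo
    the inner ones: f is 0 as soon as its derivation is inner, because f then
    extends to a homomorphism from P to the simple module S, which kills Jac P
    (inner_hom_eq0); and every restricted derivation is reached modulo inner
    ones, by lifting P -> F to the extension of F by S that the derivation
    defines (rder_lift).  Hence dim_rder_space.

    On the right, filter the derivations d by the terms of the chief series on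
    which they vanish.  As long as the next term I_{j+1} acts trivially on S, a
    derivation vanishing on I_j restricts to a homomorphism from I_{j+1} / I_j
    to S, so that a step of the filtration has dimension 0 or e by Schur's
    lemma (filtration_step); it has dimension e exactly when the chief factor
    is isomorphic to S and splits, the complement being the kernel of the
    derivation (split_of_der, der_of_split).  At the first term that does not
    act trivially, all derivations that are left are inner: L being solvable,
    the chief factor is abelian, one of its elements acts bijectively on S by
    Fitting's lemma, and that element implements the derivation (der_inner).
    A factor that counts comes from an ideal acting trivially on S, so that
    none lies higher up, and the space of all derivations has dimension
    e [L : S]_split plus that of the inner ones (dim_derivations).

    It remains to compare derivations with restricted derivations.  When S is
    not trivial they are the same, because x^p - x^{[p]} is central
    (der_restricted).  When S is trivial, derivations are the linear forms
    vanishing on [L, L] and the restricted ones vanish moreover on the span of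
    L^{[p]}; the codimensions of these annihilators differ by the correction
    term. *)

Set Implicit Arguments.
Unset Strict Implicit.
Unset Printing Implicit Defensive.

Import GRing.Theory.
Local Open Scope ring_scope.

(** * Linear algebra *)

Section Comprehension.
Variables (F : fieldType) (V : vectType F).

(** Predicates that define a subspace; those used below are not decidable in an
    evident way, and the subspace is chosen classically as a maximal one. *)
Definition linear_pred (Q : V -> Prop) : Prop :=
  Q 0 /\ forall a u v, Q u -> Q v -> Q (a *: u + v).

Lemma exists_vspace_of (Q : V -> Prop) : linear_pred Q ->
  exists W : {vspace V}, forall x, x \in W <-> Q x.
Proof.
move=> [Q0 QP].
pose d n := `[< exists W : {vspace V}, (forall x, x \in W -> Q x) /\ \dim W = n >].
have exd : exists n, d n.
  exists 0%N; apply/asboolP; exists 0%VS; rewrite dimv0; split=> // x.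
  by rewrite memv0 => /eqP->.
have ubd n : d n -> (n <= \dim {:V})%N.
  by move=> /asboolP[W [_ <-]]; rewrite dimvS ?subvf.
case: (ex_maxnP exd ubd) => n /asboolP[W [WQ dW]] maxn.
exists W => x; split=> [|Qx]; first exact: WQ.
suff : (W + <[x]> <= W)%VS by rewrite subv_add => /andP[_]; rewrite -memvE.
rewrite -(geq_leqif (dimv_leqif_sup (addvSl W <[x]>%VS))) dW; apply: maxn.
apply/asboolP; exists (W + <[x]>)%VS; split=> // _ /memv_addP[w wW [_ /vlineP[k ->] ->]].
by rewrite addrC; apply: QP => //; apply: WQ.
Qed.

Definition vspace_of (Q : V -> Prop) (hQ : linear_pred Q) : {vspace V} :=
  projT1 (cid (exists_vspace_of hQ)).

Lemma mem_vspace_of (Q : V -> Prop) (hQ : linear_pred Q) x :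
  x \in vspace_of hQ <-> Q x.
Proof. by rewrite /vspace_of; case: cid. Qed.

Lemma spanv_ind (X : set V) (Q : V -> Prop) : linear_pred Q ->
  (forall x, X x -> Q x) -> forall x, x \in spanv X -> Q x.
Proof.
move=> hQ XQ x xX; apply/(mem_vspace_of hQ); move: x xX; apply/subvP/spanv_sub.
by move=> x Xx; apply/(mem_vspace_of hQ)/XQ.
Qed.

Lemma exists_max_vspace (Q : {vspace V} -> Prop) (W0 : {vspace V}) : Q W0 ->
  exists2 W, Q W & forall W', Q W' -> (W <= W')%VS -> W' = W.
Proof.
move=> QW0; pose d n := `[< exists2 W, Q W & \dim W = n >].
have exd : exists n, d n by exists (\dim W0); apply/asboolP; exists W0.
have ubd n : d n -> (n <= \dim {:V})%N.
  by move=> /asboolP[W _ <-]; rewrite dimvS ?subvf.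
case: (ex_maxnP exd ubd) => n /asboolP[W QW dW] maxn.
exists W => // W' QW' sWW'; apply/eqP; rewrite eq_sym eqEdim sWW' dW.
by apply: maxn; apply/asboolP; exists W'.
Qed.

Lemma exists_min_vspace (Q : {vspace V} -> Prop) (W0 : {vspace V}) : Q W0 ->
  exists2 W, Q W & forall W', Q W' -> (W' <= W)%VS -> W' = W.
Proof.
move=> QW0; pose d n := `[< exists2 W, Q W & \dim W = n >].
have exd : exists n, d n by exists (\dim W0); apply/asboolP; exists W0.
case: (ex_minnP exd) => n /asboolP[W QW dW] minn.
exists W => // W' QW' sWW'; apply/eqP; rewrite eqEdim sWW' dW.
by apply: minn; apply/asboolP; exists W'.
Qed.

End Comprehension.

Lemma linfunE (F : fieldType) (V W : vectType F) (f : V -> W) (hf : linear f) :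
  exists g : 'Hom(V, W), g =1 f.
Proof.
pose f' := HB.pack_for {linear V -> W} f (GRing.isLinear.Build F V W *:%R f hf).
by exists (linfun f') => x; rewrite lfunE.
Qed.

Lemma exists_section (F : fieldType) (V W : vectType F) (f : 'Hom(V, W))
    (Y : {vspace V}) : (f @: Y)%VS = fullv ->
  exists r : 'Hom(W, V), forall s, r s \in Y /\ f (r s) = s.
Proof.
move=> fY; pose g := (f \o projv Y)%VF; exists (projv Y \o g^-1)%VF => s.
rewrite comp_lfunE memv_proj; split=> //.
rewrite -[LHS](comp_lfunE f (projv Y)) -/g limg_lfunVK //.
by rewrite limg_comp limg_proj fY memvf.
Qed.

Section Annihilator.
Variables (F : fieldType) (V W : vectType F).

Lemma ann_lin (X : {vspace V}) :
  linear_pred (fun f : 'Hom(V, W) => forall x, x \in X -> f x = 0).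
Proof.
split=> [x _|a f g fX gX x xX]; first by rewrite zero_lfunE.
by rewrite add_lfunE scale_lfunE fX // gX // scaler0 addr0.
Qed.

Definition ann_space (X : {vspace V}) : {vspace 'Hom(V, W)} := vspace_of (@ann_lin X).

Lemma ann_spaceP X f : f \in ann_space X <-> forall x, x \in X -> f x = 0.
Proof. exact: mem_vspace_of. Qed.

Lemma dim_quotv (X : {vspace V}) : \dim {:quotv X} = (\dim {:V} - \dim X)%N.
Proof. by rewrite dimvf -dimv_compl. Qed.

Lemma dim_hom : \dim {:'Hom(V, W)} = (\dim {:V} * \dim {:W})%N.
Proof. by rewrite !dimvf. Qed.

End Annihilator.

(** Maps vanishing on X are the maps from V / X. *)
Lemma dim_ann_space (F : fieldType) (V W : vectType F) (X : {vspace V}) :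
  \dim (ann_space W X) = ((\dim {:V} - \dim X) * \dim {:W})%N.
Proof.
have [c cE] : exists c : 'Hom('Hom(quotv X, W), 'Hom(V, W)),
    forall g, c g = (g \o quotv_proj X)%VF.
  apply: (@linfunE _ _ _ (fun g : 'Hom(quotv X, W) => (g \o quotv_proj X)%VF)).
  by move=> a u v; rewrite comp_lfunDl comp_lfunZl.
have kc : lker c = 0%VS.
  apply/eqP; rewrite -subv0; apply/subvP => g; rewrite memv_ker memv0 cE => /eqP g0.
  apply/eqP/lfunP => u; rewrite -(quotv_reprK (W := X) u).
  by rewrite -[LHS](comp_lfunE g (quotv_proj X)) g0 !zero_lfunE.
rewrite -dim_quotv -dim_hom -(limg_dim_eq (f := c) (U := fullv)); last by rewrite kc capv0.
congr (\dim _); apply/eqP; rewrite eqEsubv; apply/andP; split; apply/subvP => f.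
  move=> /ann_spaceP fX; apply/memv_imgP; exists (f \o quotv_repr X)%VF; first exact: memvf.
  apply/lfunP => x; rewrite cE (comp_lfunE _ (quotv_proj X)) (comp_lfunE f).
  apply/eqP; rewrite -subr_eq0 -linearB /=.
  by rewrite fX // -opprB memvN quotv_projK.
move=> /memv_imgP[g _ ->]; apply/ann_spaceP => x xX; rewrite cE (comp_lfunE g).
by have /eqP-> : quotv_proj X x == 0; rewrite ?quotv_proj_eq0 ?linear0.
Qed.

Lemma dim_subquotv (F : fieldType) (V : vectType F) (X Y : {vspace V}) : (X <= Y)%VS ->
  \dim {:subquotv X Y} = (\dim Y - \dim X)%N.
Proof.
move=> XY; rewrite dim_quotv; congr (_ - _)%N; first by rewrite dimvf.
pose v : 'Hom(subvs_of Y, V) := linfun vsval.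
have kv : lker v = 0%VS.
  apply/eqP; rewrite -subv0; apply/subvP => u; rewrite memv_ker memv0 lfunE /=.
  by move=> u0; apply/eqP/val_inj; rewrite /= (eqP u0).
rewrite -(limg_dim_eq (f := v) (U := insubv X Y)); last by rewrite kv capv0.
congr (\dim _); apply/eqP; rewrite eqEsubv; apply/andP; split; apply/subvP => u.
  by move=> /memv_imgP[w wX ->]; rewrite lfunE /= -mem_insubv.
move=> uX; apply/memv_imgP; exists (vsproj Y u).
  by rewrite mem_insubv vsprojK // (subvP XY).
by rewrite lfunE /= vsprojK // (subvP XY).
Qed.

Lemma card_set_sum n (P : nat -> bool) :
  #|[set i : 'I_n | P i]| = (\sum_(0 <= i < n) P i)%N.
Proof. by rewrite big_mkord -sum1dep_card big_mkcond; apply: eq_bigr => i _; case: (P i). Qed.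

(** * Modules over the restricted enveloping algebra *)

Section Composition.
Variables (F : fieldType) (V : vectType F) (V_proper : (0 < \dim {:V})%N).

Let dimV : (0 < dim V)%N.
Proof. by rewrite -dimvf. Qed.
Let ring := lfun_comp_nzRingType dimV.
Definition end_lalg : lalgType F :=
  HB.pack 'End(V) ring
    (GRing.Lmodule_isLalgebra.Build F ring (fun k x y => comp_lfunZl k x y)).
(** The product is composition in the usual order, so that homomorphisms into
    this algebra are left module structures on V. *)
Definition end_alg : algType F :=
  HB.pack 'End(V) end_lalg
    (GRing.Lalgebra_isAlgebra.Build F end_lalg (fun k x y => comp_lfunZr k x y)).

End Composition.


Section Envelope.
Variables (F : fieldType) (p : nat) (L : restrictedLieAlgebra F p).
Variable U : restrictedEnvelope L.

Definition env_lfun : 'Hom(L, U) :=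
  projT1 (cid (linfunE (let: And3 h _ _ := env_hom U in h))).

Lemma env_lfunE x : env_lfun x = env_inj U x.
Proof. by rewrite /env_lfun; case: cid => g /= ->. Qed.

(** The universal property factors the identity of u(L) through the subalgebra
    generated by L. *)
Lemma env_generated : agenv (limg env_lfun) = fullv :> {vspace U}.
Proof.
set B := <<limg env_lfun>>%AS.
have B1 : algid B = 1 by apply/eqP; rewrite algid_eq1 memvE sub1_agenv.
have injB x : env_inj U x \in B.
  by rewrite -env_lfunE; apply: (subvP (sub_agenv _)); exact: memv_img (memvf x).
pose i x := vsproj B (env_inj U x).
have hi : restricted_hom (p := p) (A := subvs_of B) i.
  have [lin brU pU] := env_hom U.
  split=> [a x y|x y|x]; apply: val_inj => /=.
  - by rewrite !vsprojK // lin.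
  - by rewrite !vsprojK // brU.
  suff expi k : env_inj U x ^+ k = vsval (i x ^+ k) by rewrite vsprojK // pU expi.
  elim: k => [|k IHk]; first by rewrite !expr0 /= B1.
  by rewrite !exprS /= IHk vsprojK.
have [g gi _] := env_univ U hi.
have [k _ kuniq] := env_univ U (env_hom U).
pose v (u : U) : U := vsval (g u).
have v_lin : linear v by move=> a x y; rewrite /v linearP.
have v_mon : monoid_morphism v.
  by split=> [|x y]; rewrite /v ?rmorph1 /= ?B1 ?rmorphM.
pose vM : {lrmorphism U -> U} := HB.pack v
  (GRing.isLinear.Build F U U *:%R v v_lin) (GRing.isMonoidMorphism.Build U U v v_mon).
pose idM : {lrmorphism U -> U} := idfun.
have kv := kuniq vM; have kid := kuniq idM.
apply/eqP; rewrite -(geq_leqif (dimv_leqif_eq (subvf _))) dimvS //; apply/subvP => x _.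
suff -> : x = v x by exact: subvsP.
rewrite -[LHS]/(idM x) [LHS]kid // -[RHS]/(vM x) [RHS]kv // => y /=.
by rewrite /v [g _]gi vsprojK.
Qed.

(** This takes the place of a basis of u(L) made of monomials in elements of L. *)
Lemma env_ind (Q : U -> Prop) : linear_pred Q -> Q 1 ->
  (forall x u, Q u -> Q (env_inj U x * u)) -> forall u, Q u.
Proof.
move=> hQ Q1 QL u; apply/(mem_vspace_of hQ).
suff /subvP/(_ u) : (agenv (limg env_lfun) <= vspace_of hQ)%VS.
  by apply; rewrite env_generated memvf.
apply: agenv_sub_modl; first by rewrite -memvE; apply/mem_vspace_of.
apply/prodvP => _ v /memv_imgP[x _ ->] /mem_vspace_of Qv.
by apply/mem_vspace_of; rewrite env_lfunE; exact: QL.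
Qed.

Lemma aact0l (A : falgType F) (M : algModule A) m : aact 0 m = 0 :> M.
Proof.
by have /esym/eqP := aact_linl m 1 (0 : A) 0; rewrite !scale1r addr0 -subr_eq0 addrK => /eqP.
Qed.

Lemma res_modE (M : algModule U) x (m : res_mod M) :
  lact x m = aact (env_inj U x) m :> M.
Proof. by []. Qed.

(** Since L generates u(L), linear maps and subspaces compatible with L are
    compatible with u(L). *)
Lemma alg_hom_of_lie (M N : algModule U) (f : M -> N) : linear f ->
  (forall x m, f (aact (env_inj U x) m) = aact (env_inj U x) (f m)) ->
  forall u m, f (aact u m) = aact u (f m).
Proof.
move=> lf fL; apply: env_ind.
- split=> [m|a u v fu fv m]; first by rewrite !aact0l -[0](subrr 0) -scaleN1r addrC lf scaleN1r addrC subrr.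
  by rewrite !aact_linl lf fu fv.
- by move=> m; rewrite !aact1.
- by move=> x u fu m; rewrite !aactM fL fu.
Qed.

Lemma alg_submodule_of_lie (M : algModule U) (N : {vspace M}) :
  (forall x m, m \in N -> aact (env_inj U x) m \in N) -> alg_submodule N.
Proof.
move=> hN; apply: env_ind.
- split=> [m mN|a u v fu fv m mN]; first by rewrite aact0l mem0v.
  by rewrite aact_linl memvD ?memvZ ?fu ?fv.
- by move=> m mN; rewrite aact1.
- by move=> x u hu m mN; rewrite aactM hN ?hu.
Qed.

Lemma restricted_res_mod (M : algModule U) : restricted_module (res_mod M).
Proof.
move=> x m; rewrite res_modE; case: (env_hom U) => _ _ ->.
suff: forall k, aact (env_inj U x ^+ k) m = iter k (lact x) (m : res_mod M) by apply.
elim=> [|k IHk]; first by rewrite expr0 aact1.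
by rewrite exprS aactM IHk.
Qed.

(** The universal property, applied to the algebra of endomorphisms of M, turns
    M into a u(L)-module; that algebra is non-trivial only for a non-zero M. *)
Section RestrictedModule.
Variables (M : lieModule L) (rM : restricted_module M) (dM : (0 < \dim {:M})%N).

Lemma restricted_action_exists :
  exists act : U -> M -> M, [/\ forall m, linear (act^~ m), forall a, linear (act a),
    forall m, act 1 m = m, forall a b m, act (a * b) m = act a (act b m) &
    forall x m, act (env_inj U x) m = lact x m].
Proof.
pose f x : end_alg dM := linfun (@lact F L M x).
have fE x m : (f x : 'End(M)) m = lact x m by rewrite lfunE.
have hf : restricted_hom (p := p) f.
  split=> [a x y|x y|x]; apply/lfunP => m.
  - by rewrite fE add_lfunE scale_lfunE !fE lact_linl.
  - by rewrite fE add_lfunE opp_lfunE !comp_lfunE !fE lact_br.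
  rewrite fE rM; suff: forall k, iter k (lact x) m = (f x ^+ k : 'End(M)) m by [].
  elim=> [|k IHk]; first by rewrite expr0 id_lfunE.
  by rewrite exprS comp_lfunE -IHk fE.
have [g gf _] := env_univ U hf.
exists (fun u m => (g u : 'End(M)) m); split=> [m a u v|a|m|a b m|x m].
- by rewrite linearP add_lfunE scale_lfunE.
- exact: linearP.
- by rewrite rmorph1 id_lfunE.
- by rewrite rmorphM comp_lfunE.
- by have := gf x; rewrite /= => ->; rewrite fE.
Qed.

Definition restricted_action : U -> M -> M := projT1 (cid restricted_action_exists).

Let actP := projT2 (cid restricted_action_exists).

Lemma restricted_action_linl m : linear (restricted_action^~ m).
Proof. by case: actP => h _ _ _ _; exact: h. Qed.

Lemma restricted_action_linr a : linear (restricted_action a).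
Proof. by case: actP => _ h _ _ _; exact: h. Qed.

Lemma restricted_action1 m : restricted_action 1 m = m.
Proof. by case: actP => _ _ h _ _; exact: h. Qed.

Lemma restricted_actionM a b m :
  restricted_action (a * b) m = restricted_action a (restricted_action b m).
Proof. by case: actP => _ _ _ h _; exact: h. Qed.

Definition alg_of_restricted : algModule U :=
  AlgModule restricted_action_linl restricted_action_linr restricted_action1
    restricted_actionM.

Lemma alg_of_restrictedE x (m : M) :
  @aact F U alg_of_restricted (env_inj U x) m = lact x m.
Proof. by case: actP => _ _ _ _ h; exact: h. Qed.

End RestrictedModule.

End Envelope.

(** * The radical of a finite-dimensional algebra *)

Section Radical.
Variables (F : fieldType) (A : falgType F).

Lemma left_ideal_cap (I J : {vspace A}) :
  left_ideal I -> left_ideal J -> left_ideal (I :&: J)%VS.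
Proof. by move=> lI lJ a b; rewrite !memv_cap => /andP[/lI-> /lJ->]. Qed.

Lemma left_ideal_add (I J : {vspace A}) :
  left_ideal I -> left_ideal J -> left_ideal (I + J)%VS.
Proof.
move=> lI lJ a _ /memv_addP[b bI [c cJ ->]].
by rewrite mulrDr memv_add ?lI ?lJ.
Qed.

Lemma left_ideal_principal (y : A) : left_ideal (limg (amulr y)).
Proof.
move=> a _ /memv_imgP[b _ ->]; rewrite !lfunE /= mulrA.
by apply/memv_imgP; exists (a * b); rewrite ?memvf // lfunE.
Qed.

Definition minimal_over_Jac (E : {vspace A}) : Prop :=
  [/\ left_ideal E, (Jac A <= E)%VS &
      forall E', left_ideal E' -> (Jac A <= E')%VS -> (E' <= E)%VS ->
        E' = Jac A \/ E' = E].

(** The socle of A / Jac A is everything.  A left ideal K with K + V = A that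
    is minimal for this property is Jac A: otherwise K contains some E minimal
    over Jac A, and some maximal left ideal I misses E, so that K :&: I is a
    smaller supplement of V. *)
Lemma minimal_over_Jac_generate (V : {vspace A}) : (Jac A <= V)%VS ->
  (forall E, minimal_over_Jac E -> (E <= V)%VS) -> V = fullv.
Proof.
move=> JV EV.
have [|K [lK JK KV] minK] := @exists_min_vspace F A
    (fun K => [/\ left_ideal K, (Jac A <= K)%VS & (K + V = fullv)%VS]) fullv.
  split; [by move=> *; rewrite memvf|exact: subvf|].
  by apply/eqP; rewrite -(geq_leqif (dimv_leqif_eq (subvf _))) dimvS ?addvSl.
have [KJ|/eqP nKJ] := eqVneq K (Jac A).
  by rewrite -KV KJ; apply/esym/addv_idPr.
have [|E [lE JE EK nEJ] minE] := @exists_min_vspace F A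
    (fun E => [/\ left_ideal E, (Jac A <= E)%VS, (E <= K)%VS & E <> Jac A]) K.
  by split.
have mE : minimal_over_Jac E.
  split=> // E' lE' JE' sE'; have [->|/eqP ne] := eqVneq E' (Jac A); first by left.
  by right; apply: minE => //; split=> //; exact: subv_trans EK.
have /subvPn[y yE yJ] : ~~ (E <= Jac A)%VS.
  by apply/negP => EJ; apply: nEJ; apply/eqP; rewrite eqEsubv EJ.
have [I mI yI] : exists2 I, maximal_left_ideal I & y \notin I.
  apply: contrapT => h; move/negP: yJ; apply; apply/bigcapvP => I mI.
  by apply: contrapT => /negP yI; apply: h; exists I.
have [lI _ maxI] := mI.
have JI : (Jac A <= I)%VS by apply/subvP => z /bigcapvP; apply.
have IE : (I + E = fullv)%VS.
  case: (maxI _ (left_ideal_add lI lE) (addvSl I E)) => // h.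
  by move/negP: yI; case; rewrite -h (subvP (addvSr I E)).
suff KI : (K <= I)%VS by move/negP: yI; case; rewrite (subvP KI) ?(subvP EK).
suff <- : (K :&: I)%VS = K by exact: capvSr.
apply: minK; last exact: capvSl.
split; [exact: left_ideal_cap|by rewrite subv_cap JK|].
apply/eqP; rewrite eqEsubv subvf -KV subv_add addvSr andbT.
apply/subvP => k kK; have := memvf k; rewrite -IE => /memv_addP[i iI [e eE def_k]].
rewrite def_k memv_add //; last exact: (subvP (EV _ mE)).
by rewrite memv_cap iI andbT -[i](addrK e) -def_k memvB // (subvP EK).
Qed.

Definition act_on (M : algModule A) (m : M) : 'Hom(A, M) :=
  projT1 (cid (linfunE (aact_linl m))).

Lemma act_onE (M : algModule A) (m : M) a : act_on m a = aact a m.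
Proof. by rewrite /act_on; case: cid. Qed.

Lemma mem_actv (M : algModule A) (I : {vspace A}) a (m : M) :
  a \in I -> aact a m \in actv M I.
Proof. by move=> aI; apply: mem_spanv; exists a, m. Qed.

Lemma alg_submodule_add (M : algModule A) (X Y : {vspace M}) :
  alg_submodule X -> alg_submodule Y -> alg_submodule (X + Y)%VS.
Proof.
move=> sX sY a _ /memv_addP[x xX [y yY ->]].
by rewrite linearD memv_add ?sX ?sY.
Qed.

(** This says that M / (Jac A) M is semisimple.  Take K maximal among the
    submodules that contain (Jac A) M and meet N inside it: if K + N were not M,
    it would miss E m for some E minimal over Jac A, and K + E m would be
    larger. *)
Lemma supplement_mod_Jac (M : algModule A) (N : {vspace M}) : alg_submodule N ->
  exists K : {vspace M},
    [/\ alg_submodule K, (K + N = fullv)%VS & (K :&: N <= actv M (Jac A))%VS].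
Proof.
move=> sN; set R := actv M (Jac A).
have sR : alg_submodule R by apply: alg_submodule_actv; exact: left_ideal_Jac.
have [|K [sK RK KN] maxK] := @exists_max_vspace F M
    (fun K => [/\ alg_submodule K, (R <= K)%VS & (K :&: N <= R)%VS]) R.
  by split=> //; exact: capvSl.
exists K; split=> //; apply/eqP; rewrite eqEsubv subvf; apply/subvP => m _.
have sKN := alg_submodule_add sK sN.
suff : (act_on m @^-1: (K + N))%VS = fullv.
  by move/(congr1 (fun V : {vspace A} => 1 \in V)); rewrite memvf -memv_preim act_onE aact1.
apply: minimal_over_Jac_generate => [|E [lE JE minE]].
  apply/subvP => a aJ; rewrite -memv_preim act_onE.
  exact/(subvP (addvSl K N))/(subvP RK)/mem_actv.
apply: contrapT => /negP/subvPn[y0 y0E]; rewrite -memv_preim act_onE => y0m.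
have sX : alg_submodule (act_on m @: E)%VS.
  move=> a _ /memv_imgP[b bE ->]; rewrite act_onE -aactM -act_onE.
  exact/memv_img/lE.
have defK : (K + act_on m @: E)%VS = K.
  apply: maxK; last exact: addvSl.
  split; [exact: alg_submodule_add|exact: subv_trans (addvSl _ _)|].
  apply/subvP => _ /memv_capP[/memv_addP[k kK [_ /memv_imgP[y yE ->] ->]]].
  rewrite act_onE => zN.
  have ymKN : aact y m \in (K + N)%VS.
    by rewrite -[aact y m](addKr k) addrC addrC memv_add ?memvN.
  have [yJ|yJ] := boolP (y \in Jac A).
    apply: (subvP KN); rewrite memv_cap zN memvD //.
    by apply: (subvP RK); exact: mem_actv.
  case/negP: y0m.
  have lJy := left_ideal_add (@left_ideal_Jac F A) (left_ideal_principal (y := y)).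
  case: (minE _ lJy (addvSl _ _)).
  - rewrite subv_add JE; apply/subvP => _ /memv_imgP[a _ ->].
    by rewrite lfunE /=; exact: lE.
  - move=> h; case/negP: yJ; rewrite -h; apply: (subvP (addvSr _ _)).
    by apply/memv_imgP; exists 1; rewrite ?memvf // lfunE /= mul1r.
  move=> h; move: y0E; rewrite -h => /memv_addP[j jJ [_ /memv_imgP[a _ ->] ->]].
  rewrite lfunE /= -act_onE linearD /= !act_onE aactM memvD ?(sKN a) //.
  exact/(subvP (addvSl K N))/(subvP RK)/mem_actv.
case/negP: y0m; apply: (subvP (addvSl K N)); rewrite -defK.
by apply: (subvP (addvSr _ _)); rewrite -act_onE memv_img.
Qed.

(** The annihilator of a non-zero element of a simple module is a maximal left
    ideal. *)
Lemma Jac_kills_simple (M : algModule A) :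
  (forall N : {vspace M}, alg_submodule N -> N = 0%VS \/ N = fullv) ->
  forall a (m : M), a \in Jac A -> aact a m = 0.
Proof.
move=> irrM a m aJ; have [->|m0] := eqVneq m 0; first exact: linear0.
suff mx : maximal_left_ideal (lker (act_on m)).
  by move/bigcapvP: aJ => /(_ _ mx); rewrite memv_ker act_onE => /eqP.
split=> [b c||J lJ].
- by rewrite !memv_ker !act_onE aactM => /eqP->; rewrite linear0.
- apply/eqP => /(congr1 (fun V : {vspace A} => 1 \in V)).
  by rewrite memvf memv_ker act_onE aact1 (negbTE m0).
move=> kJ; have sJ : alg_submodule (act_on m @: J)%VS.
  move=> b _ /memv_imgP[c cJ ->]; rewrite act_onE -aactM -act_onE.
  exact/memv_img/lJ.
case: (irrM _ sJ) => hJ.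
  by left; apply/eqP; rewrite eqEsubv kJ andbT lkerE hJ.
right; have := memvf m; rewrite -hJ => /memv_imgP[b bJ]; rewrite act_onE => mb.
have b1J : 1 - b \in J.
  apply: (subvP kJ); rewrite memv_ker linearB /= !act_onE aact1 -mb.
  by rewrite subrr.
apply/eqP; rewrite eqEsubv subvf; apply/subvP => c _.
by rewrite -[c]mulr1 lJ // -[1](subrK b) memvD.
Qed.

End Radical.

(** * Simple factors of a Lie module *)

Section Factors.
Variables (F : fieldType) (L : lieAlgebra F).
Implicit Types M S : lieModule L.

(** Irreducibility of Y / X, expressed inside M: it serves both for composition
    factors and for chief factors, whose quotients are formed differently. *)
Definition simple_factor M (X Y : lieSubmodule M) : Prop :=
  [/\ (X <= Y)%VS, (X : {vspace M}) <> Y &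
      forall K : lieSubmodule M, (X <= K)%VS -> (K <= Y)%VS ->
        K = X :> {vspace M} \/ K = Y :> {vspace M}].

Lemma lie_iso_dim (M N : lieModule L) : lie_iso M N -> \dim {:M} = \dim {:N}.
Proof.
move=> [f bij_f _]; have kf : lker f == 0%VS by apply/lker0P; exact: bij_inj.
have <- : limg f = fullv.
  apply/eqP; rewrite eqEsubv subvf; apply/subvP => v _.
  by case: bij_f => g _ gK; rewrite -[v]gK memv_img ?memvf.
by rewrite limg_dim_eq // (eqP kf) capv0.
Qed.

Section FactorProj.
Variables (M : lieModule L) (X Y : lieSubmodule M).

(** The projection of Y onto Y / X, extended arbitrarily to M. *)
Definition factor_proj : 'Hom(M, subquot_mod X Y) :=
  (quotv_proj (insubv X Y) \o linfun (vsproj Y))%VF.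

Lemma factor_projE m : factor_proj m = quotv_proj (insubv X Y) (vsproj Y m).
Proof. by rewrite /factor_proj comp_lfunE; congr (quotv_proj _ _); rewrite lfunE. Qed.

Lemma factor_proj_eq0 m : m \in Y -> (factor_proj m == 0) = (m \in X).
Proof. by move=> mY; rewrite factor_projE quotv_proj_eq0 mem_insubv vsprojK. Qed.

Lemma factor_proj_act x m : m \in Y ->
  factor_proj (lact x m) = lact x (factor_proj m).
Proof.
move=> mY; rewrite !factor_projE [RHS]quot_actE; congr (quotv_proj _ _).
by apply: val_inj; rewrite /= !vsprojK // ls_stable.
Qed.

Lemma factor_proj_surj u : exists2 m, m \in Y & u = factor_proj m.
Proof.
exists (vsval (quotv_repr (insubv X Y) u)); first exact: subvsP.
by rewrite factor_projE vsvalK [RHS]quotv_reprK.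
Qed.

Lemma exists_factor_map (V : vectType F) (f : 'Hom(M, V)) :
  (forall m, m \in X -> f m = 0) ->
  exists g : 'Hom(subquot_mod X Y, V), forall y, y \in Y -> g (factor_proj y) = f y.
Proof.
move=> fX; have hg : linear (fun u : subquot_mod X Y =>
    f (vsval (quotv_repr (insubv X Y) u))).
  by move=> a u v; rewrite linearP /= !linearP.
have [g gE] := linfunE hg; exists g => y yY.
rewrite gE factor_projE; apply/eqP; rewrite -subr_eq0 -linearB /=.
apply/eqP/fX; have := quotv_projK (insubv X Y) (vsproj Y y).
by rewrite mem_insubv linearB /= vsprojK.
Qed.

Lemma irreducible_simple_factor : (X <= Y)%VS ->
  lie_irreducible (subquot_mod X Y) -> simple_factor X Y.
Proof.
move=> XY [d0 irr]; split=> // [eXY|K XK KY].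
  case/negP: d0; rewrite dimv_eq0 -subv0; apply/subvP => u _.
  have [m mY ->] := factor_proj_surj u.
  by rewrite memv0 factor_proj_eq0 // eXY.
have sK x u : u \in (factor_proj @: K)%VS -> lact x u \in (factor_proj @: K)%VS.
  move=> /memv_imgP[k kK ->]; rewrite -factor_proj_act ?(subvP KY) //.
  by rewrite memv_img // ls_stable.
have [h|h] := irr (LieSubmodule sK); [left|right]; apply/eqP; rewrite eqEsubv.
  rewrite XK andbT; apply/subvP => k kK.
  by rewrite -factor_proj_eq0 ?(subvP KY) // -memv0 -[0%VS]h memv_img.
rewrite KY; apply/subvP => m mY; have := memvf (factor_proj m).
rewrite -h => /memv_imgP[k kK /eqP]; rewrite -subr_eq0 -linearB /=.
rewrite factor_proj_eq0; last by rewrite memvB // (subvP KY).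
move=> /(subvP XK) mk.
by rewrite -(subrK k m) memvD.
Qed.

End FactorProj.

Lemma chief_simple_factor (I J : lieIdeal L) : (I <= J)%VS ->
  minimal_ideal (factor_in I J) -> simple_factor I J.
Proof.
move=> IJ [_ n0 minJ]; split=> // [eIJ|K IK KJ].
  case/negP: n0; rewrite -subv0; apply/subvP => _ /memv_imgP[j jJ ->].
  by rewrite memv0 quotv_proj_eq0 eIJ.
have sK (x u : quot_lie I) : u \in (quotv_proj I @: K)%VS ->
    br x u \in (quotv_proj I @: K)%VS.
  move=> /memv_imgP[k kK ->]; rewrite -[x](quotv_reprK (W := I)) [br _ _]quot_brE.
  by rewrite memv_img //; exact: (@ls_stable _ _ _ K).
have := minJ (@LieSubmodule _ _ (adj_mod (quot_lie I)) _ sK) (limgS _ KJ).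
case=> h; [left|right]; apply/eqP; rewrite eqEsubv.
  rewrite IK andbT; apply/subvP => k kK.
  by rewrite -quotv_proj_eq0 -memv0 -[0%VS]h memv_img.
rewrite KJ; apply/subvP => m mJ; have := memv_img (quotv_proj I) mJ.
rewrite -[(quotv_proj I @: J)%VS]h => /memv_imgP[k kK /eqP].
rewrite quotv_proj_eq => /(subvP IK) mk.
by rewrite -(subrK k m) memvD.
Qed.

Lemma end_lin S : linear_pred (fun f : 'Hom(S, S) => forall x s, f (lact x s) = lact x (f s)).
Proof.
split=> [x s|a f g fx gx x s]; first by rewrite !lfunE /= linear0.
by rewrite !lfunE /= !lfunE /= fx gx linearP.
Qed.

Definition end_space S : {vspace 'Hom(S, S)} := vspace_of (@end_lin S).

Lemma end_spaceP S f : f \in end_space S <-> forall x s, f (lact x s) = lact x (f s).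
Proof. exact: mem_vspace_of. Qed.

Lemma end_space_gt0 S : lie_irreducible S -> (0 < \dim (end_space S))%N.
Proof.
move=> [d0 _]; rewrite lt0n dimv_eq0; apply/eqP => E0.
have : \1%VF \in end_space S by apply/end_spaceP => x s; rewrite !lfunE.
rewrite E0 memv0 => /eqP h; case/negP: d0; rewrite dimv_eq0 -subv0.
by apply/subvP => s _; rewrite memv0 -[s]id_lfunE h lfunE.
Qed.

Section Step.
Variables (M S : lieModule L) (X Y : lieSubmodule M).
Hypotheses (irrS : lie_irreducible S) (sXY : simple_factor X Y).

(** f restricts to a homomorphism from Y / X to S. *)
Definition factor_hom (f : 'Hom(M, S)) : Prop :=
  (forall m, m \in X -> f m = 0) /\
  (forall x y, y \in Y -> f (lact x y) = lact x (f y)).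

Definition kills (f : 'Hom(M, S)) : Prop := forall y, y \in Y -> f y = 0.

Lemma factor_hom_inj f : factor_hom f -> ~ kills f ->
  forall y, y \in Y -> f y = 0 -> y \in X.
Proof.
move=> [fX fY] nf y yY fy0; have [XY _ minY] := sXY.
have sK x m : m \in (Y :&: lker f)%VS -> lact x m \in (Y :&: lker f)%VS.
  rewrite !memv_cap !memv_ker => /andP[mY /eqP fm].
  by rewrite ls_stable // fY // fm linear0 eqxx.
have [||h|h] := minY (LieSubmodule sK).
- by apply/subvP => m mX; rewrite memv_cap (subvP XY) //= memv_ker fX.
- exact: capvSl.
- by rewrite -[(X : {vspace M})]h memv_cap yY memv_ker fy0 /=.
case: nf => z; rewrite -[(Y : {vspace M})]h memv_cap memv_ker => /andP[_ /eqP].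
by [].
Qed.

Lemma factor_hom_surj f : factor_hom f -> ~ kills f -> (f @: Y)%VS = fullv.
Proof.
move=> [fX fY] nf; have sK x s : s \in (f @: Y)%VS -> lact x s \in (f @: Y)%VS.
  by move=> /memv_imgP[y yY ->]; rewrite -fY // memv_img // ls_stable.
case: irrS => _ /(_ (LieSubmodule sK)) [h|//]; case: nf => y yY.
by apply/eqP; rewrite -memv0 -[0%VS]h memv_img.
Qed.

Lemma factor_hom_iso f : factor_hom f -> ~ kills f -> lie_iso (subquot_mod X Y) S.
Proof.
move=> hf nf; have [fX fY] := hf; have [g gp] := exists_factor_map Y fX.
exists g; last first.
  move=> x u; have [y yY ->] := factor_proj_surj u.
  by rewrite -factor_proj_act // !gp ?ls_stable // fY.
have kg : lker g == 0%VS.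
  rewrite -subv0; apply/subvP => u; rewrite memv_ker.
  have [y yY ->] := factor_proj_surj u; rewrite gp // => /eqP fy.
  by rewrite memv0 factor_proj_eq0 // (factor_hom_inj hf nf).
have lg : limg g = fullv.
  apply/eqP; rewrite eqEsubv subvf; apply/subvP => s _; have := memvf s.
  rewrite -(factor_hom_surj hf nf) => /memv_imgP[y yY ->]; rewrite -gp //.
  by rewrite memv_img ?memvf.
exists g^-1%VF; first exact: lker0_lfunK.
by move=> s; rewrite limg_lfunVK // lg memvf.
Qed.

Lemma iso_factor_hom : lie_iso (subquot_mod X Y) S ->
  exists g, [/\ factor_hom g, ~ kills g & forall y, y \in Y -> g y = 0 -> y \in X].
Proof.
move=> [h bij_h hL]; have [XY nXY _] := sXY.
have h0 u : h u = 0 -> u = 0 by move=> hu; apply: (bij_inj bij_h); rewrite hu linear0.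
exists (h \o factor_proj X Y)%VF.
have cE y : (h \o factor_proj X Y)%VF y = h (factor_proj X Y y) by rewrite comp_lfunE.
have gX y : y \in Y -> (h \o factor_proj X Y)%VF y = 0 -> y \in X.
  by move=> yY; rewrite cE => /h0/eqP; rewrite factor_proj_eq0.
split=> //.
  split=> [m mX|x y yY]; rewrite !cE ?factor_proj_act ?hL //.
  have /eqP-> : factor_proj X Y m == 0 by rewrite factor_proj_eq0 // (subvP XY).
  exact: linear0.
move=> kg; apply: nXY; apply/eqP; rewrite eqEsubv XY; apply/subvP => y yY.
by apply: gX => //; exact: kg.
Qed.

(** By Schur's lemma, any two maps in H that do not kill Y differ on Y by an
    endomorphism of S.  Equivariance is required on Y only, because the
    derivations to which this applies are equivariant only there. *)
Lemma filtration_step (H H' : {vspace 'Hom(M, S)}) :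
  (forall f, f \in H -> factor_hom f) ->
  (forall phi f, phi \in end_space S -> f \in H -> (phi \o f)%VF \in H) ->
  (forall f, f \in H' <-> f \in H /\ kills f) ->
  \dim H = (\dim H' + `[< exists2 f, f \in H & ~ kills f >] * \dim (end_space S))%N.
Proof.
move=> hH EH hH'; have H'H : (H' <= H)%VS by apply/subvP => f /hH'[].
case: asboolP => [[f0 f0H nf0]|nex]; last first.
  rewrite mul0n addn0; apply/eqP; rewrite eqn_leq [X in _ && X]dimvS // andbT.
  apply/dimvS/subvP => f fH; apply/hH'; split=> //; apply: contrapT => nf.
  by apply: nex; exists f.
rewrite mul1n.
have [c cE] : exists c : 'Hom('Hom(S, S), 'Hom(M, S)), forall g, c g = (g \o f0)%VF.
  apply: (@linfunE _ _ _ (fun g => (g \o f0)%VF)) => a u v.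
  by rewrite comp_lfunDl comp_lfunZl.
have sf0 := factor_hom_surj (hH _ f0H) nf0.
have cinj : (end_space S :&: lker c)%VS = 0%VS.
  apply/eqP; rewrite -subv0; apply/subvP => g; rewrite memv_cap memv_ker memv0 cE.
  move=> /andP[_ /eqP g0]; apply/eqP/lfunP => s; rewrite lfunE.
  have := memvf s; rewrite -sf0 => /memv_imgP[y _ ->].
  by rewrite -comp_lfunE g0 lfunE.
rewrite -(limg_dim_eq cinj) -dimv_disjoint_sum; last first.
  apply/eqP; rewrite -subv0; apply/subvP => f; rewrite memv_cap memv0.
  move=> /andP[/hH'[_ kf] /memv_imgP[g _ def_f]]; rewrite def_f.
  suff -> : g = 0 by rewrite linear0.
  apply/lfunP => s; rewrite lfunE; have := memvf s; rewrite -sf0.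
  by move=> /memv_imgP[y yY ->]; rewrite -comp_lfunE -cE -def_f kf.
congr (\dim _); apply/eqP; rewrite eqEsubv subv_add H'H /=; apply/andP; split; last first.
  by apply/subvP => _ /memv_imgP[g gE ->]; rewrite cE EH.
apply/subvP => f fH; have [fX fY] := hH _ fH; have [f0X f0Y] := hH _ f0H.
have [r rP] := exists_section sf0.
have fr y : y \in Y -> f (r (f0 y)) = f y.
  move=> yY; have [rY f0r] := rP (f0 y); apply/eqP; rewrite -subr_eq0 -linearB /=.
  apply/eqP/fX/(factor_hom_inj (hH _ f0H) nf0); first by rewrite memvB.
  by rewrite linearB /= f0r subrr.
have gE : (f \o r)%VF \in end_space S.
  apply/end_spaceP => x s; rewrite !comp_lfunE; have [rY {1}<-] := rP s.
  by rewrite -f0Y // fr ?ls_stable // fY.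
rewrite -[f](subrK (c (f \o r)%VF)) memv_add ?memv_img //.
apply/hH'; split=> [|y yY]; first by rewrite memvB // cE EH.
by rewrite add_lfunE opp_lfunE cE !comp_lfunE fr // subrr.
Qed.

End Step.

End Factors.

(** * Derivations into an irreducible module *)

Section Derivations.
Variables (F : fieldType) (L : lieAlgebra F) (S : lieModule L).

Definition derivation (d : 'Hom(L, S)) : Prop :=
  forall x y, d (br x y) = lact x (d y) - lact y (d x).

Lemma lact0l (M : lieModule L) m : lact 0 m = 0 :> M.
Proof.
by have /esym/eqP := lact_linl m 1 0 0; rewrite !scale1r addr0 -subr_eq0 addrK => /eqP.
Qed.

Lemma der_lin (X : {vspace L}) :
  linear_pred (fun d : 'Hom(L, S) => derivation d /\ forall x, x \in X -> d x = 0).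
Proof.
split; first by split=> [x y|x _]; rewrite !zero_lfunE // !linear0 addr0.
move=> a d e [hd dX] [he eX]; split=> [x y|x xX]; rewrite !add_lfunE !scale_lfunE.
  by rewrite hd he !lact_linr scalerBr opprD addrACA.
by rewrite dX // eX // scaler0 addr0.
Qed.

Definition der_space (X : {vspace L}) : {vspace 'Hom(L, S)} := vspace_of (@der_lin X).

Lemma der_spaceP X d :
  d \in der_space X <-> derivation d /\ forall x, x \in X -> d x = 0.
Proof. exact: mem_vspace_of. Qed.

Lemma inner_lin (s : S) : linear (fun x : L => lact x s).
Proof. exact: lact_linl. Qed.

Definition inner (s : S) : 'Hom(L, S) := projT1 (cid (linfunE (@inner_lin s))).

Lemma innerE s x : inner s x = lact x s.
Proof. by rewrite /inner; case: cid => g /= ->. Qed.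

Lemma inner_linear : linear inner.
Proof.
by move=> a s t; apply/lfunP => x; rewrite add_lfunE scale_lfunE !innerE linearP.
Qed.

Definition inner_map : 'Hom(S, 'Hom(L, S)) := projT1 (cid (linfunE inner_linear)).

Lemma inner_mapE s : inner_map s = inner s.
Proof. by rewrite /inner_map; case: cid => g /= ->. Qed.

Definition inner_space : {vspace 'Hom(L, S)} := limg inner_map.

Lemma inner_spaceP d : d \in inner_space <-> exists s, forall x, d x = lact x s.
Proof.
split=> [/memv_imgP[s _ ->]|[s ds]]; first by exists s => x; rewrite inner_mapE innerE.
by apply/memv_imgP; exists s; rewrite ?memvf //; apply/lfunP => x; rewrite inner_mapE innerE.
Qed.

Definition acts_trivially (X : {vspace L}) : Prop :=
  forall x, x \in X -> forall s : S, lact x s = 0.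

Lemma inner_der X : acts_trivially X -> (inner_space <= der_space X)%VS.
Proof.
move=> tX; apply/subvP => d /inner_spaceP[s ds]; apply/der_spaceP; split=> [x y|x xX].
  by rewrite !ds lact_br.
by rewrite ds tX.
Qed.

Section Vanishing.
Variables (X Y : lieIdeal L).
Hypotheses (irrS : lie_irreducible S) (tX : acts_trivially X) (ntY : ~ acts_trivially Y).
Hypothesis (YY : forall x y, x \in Y -> y \in Y -> br x y \in X).

Lemma lact_comm a b s : a \in Y -> b \in Y -> lact a (lact b s) = lact b (lact a s) :> S.
Proof. by move=> aY bY; apply/eqP; rewrite -subr_eq0 -lact_br tX // YY. Qed.

Lemma brY a x : a \in Y -> br a x \in Y.
Proof. by move=> aY; rewrite br_anti memvN; exact: (@ls_stable _ _ _ Y). Qed.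

Lemma iter_lact0 (a : L) n : iter n (lact a) 0 = 0 :> S.
Proof. by elim: n => //= n ->; rewrite linear0. Qed.

(** The Fitting null component of an element a of Y is a submodule: modulo
    operators acting as 0, the commutator of a with x again commutes with a, so
    that one more power of a suffices. *)
Lemma fitting_null_stable a n x s : a \in Y -> iter n (lact a) s = 0 :> S ->
  iter n.+1 (lact a) (lact x s) = 0.
Proof.
move=> aY; elim: n s => [s /= ->|n IHn s an]; first by rewrite !linear0.
have comm k b t : b \in Y -> iter k (lact a) (lact b t) = lact b (iter k (lact a) t) :> S.
  by move=> bY; elim: k => //= k ->; rewrite lact_comm.
have axs : lact a (lact x s) = lact x (lact a s) + lact (br a x) s.
  by rewrite lact_br addrC subrK.
have iterD k (t u : S) : iter k (lact a) (t + u) = iter k (lact a) t + iter k (lact a) u.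
  by elim: k => //= k ->; rewrite linearD.
rewrite iterSr axs iterD IHn; last by rewrite -iterSr.
by rewrite comm ?brY // an linear0 addr0.
Qed.

Lemma null_lin a : linear_pred (fun s : S => exists n, iter n (lact a) s = 0).
Proof.
split=> [|k u v [i ui] [j vj]]; first by exists 0%N.
exists (i + j)%N; have iterP n : iter n (lact a) (k *: u + v) =
    k *: iter n (lact a) u + iter n (lact a) v.
  by elim: n => //= n ->; rewrite linearP.
by rewrite iterP {1}addnC !iterD ui vj !iter_lact0 scaler0 addr0.
Qed.

(** Otherwise every Fitting null component is all of S, so that Y acts by
    commuting nilpotent operators; these have a common null vector, and the
    common null vectors form a submodule. *)
Lemma exists_injective : exists2 a, a \in Y & forall s : S, lact a s = 0 -> s = 0.
Proof.
apply: contrapT => none.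
have nil a (s : S) : a \in Y -> exists n, iter n (lact a) s = 0.
  move=> aY; have sN x t : t \in vspace_of (@null_lin a) -> lact x t \in vspace_of (@null_lin a).
    move=> /mem_vspace_of[n an]; apply/mem_vspace_of; exists n.+1.
    exact: fitting_null_stable.
  have [_ /(_ (LieSubmodule sN))[h|h]] := irrS.
    case: none; exists a => // t at0; apply/eqP; rewrite -memv0 -[0%VS]h.
    by apply/mem_vspace_of; exists 1%N.
  have : s \in vspace_of (@null_lin a) by rewrite [vspace_of _]h memvf.
  by move/mem_vspace_of.
have [d0 _] := irrS.
have [|W [W0 sW] minW] := @exists_min_vspace F S
    (fun W => W != 0%VS /\ forall y, y \in Y -> forall s, s \in W -> lact y s \in W) fullv.
  by rewrite -dimv_eq0; split=> // y _ s _; rewrite memvf.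
have W_killed y (s : S) : y \in Y -> s \in W -> lact y s = 0.
  move=> yY; suff <- : (W :&: lker (linfun (@lact F L S y)))%VS = W.
    by rewrite memv_cap memv_ker lfunE => /andP[_ /eqP].
  apply: minW; last exact: capvSl.
  split=> [|z zY t]; last first.
    rewrite !memv_cap !memv_ker !lfunE => /andP[tW /eqP /= yt].
    by rewrite sW //= lact_comm // yt linear0.
  (* the last non-zero vector among w, y w, y^2 w, ... is killed by y *)
  have [w wW w0] : exists2 w, w \in W & w != 0.
    by exists (vpick W); rewrite ?memv_pick // vpick0.
  have exn : exists n, iter n (lact y) w == 0.
    by have [n /eqP] := nil y w yY; exists n.
  case: (ex_minnP exn) => -[|n] /=; first by rewrite (negbTE w0).
  move=> /eqP yn minn; have nz : iter n (lact y) w != 0.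
    by apply/negP => /minn; rewrite ltnn.
  apply/negP => h; case/negP: nz; rewrite -memv0 -(eqP h) memv_cap memv_ker lfunE /= yn.
  rewrite eqxx andbT; elim: (n) => //= k; exact: sW.
have nullY : linear_pred (fun s : S => forall y, y \in Y -> lact y s = 0).
  split=> [y _|k u v uY vY y yY]; first exact: linear0.
  by rewrite linearP /= uY // vY // scaler0 addr0.
have sN x s : s \in vspace_of nullY -> lact x s \in vspace_of nullY.
  move=> /mem_vspace_of sY; apply/mem_vspace_of => y yY.
  have := lact_br y x s; rewrite (sY y) // linear0 subr0 => <-.
  by rewrite sY // brY.
have [_ /(_ (LieSubmodule sN))[h|h]] := irrS.
  case/negP: W0; rewrite -subv0 -[0%VS]h; apply/subvP => s sW'.
  by apply/mem_vspace_of => y yY; exact: W_killed.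
apply: ntY => y yY s; have : s \in vspace_of nullY by rewrite [vspace_of _]h memvf.
by move/mem_vspace_of; apply.
Qed.

(** If a in Y acts bijectively on S, then a derivation d vanishing on X is
    inner on Y, implemented by a^-1 (d a), since a . d b = b . d a for b in Y;
    a derivation that vanishes on Y has its values in S^Y = 0. *)
Lemma der_inner d : derivation d -> (forall x, x \in X -> d x = 0) -> d \in inner_space.
Proof.
move=> dd dX; have [a aY ainj] := exists_injective.
pose la : 'Hom(S, S) := linfun (@lact F L S a).
have kla : lker la == 0%VS.
  by rewrite -subv0; apply/subvP => s; rewrite memv_ker lfunE memv0 => /eqP/ainj->.
pose s := (la^-1)%VF (d a).
have as_ : lact a s = d a by rewrite -[LHS](lfunE (@lact F L S a)) lker0_lfunVK.
have dY b : b \in Y -> d b = lact b s.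
  move=> bY; apply/eqP; rewrite -subr_eq0; apply/eqP/ainj.
  rewrite linearB /= (lact_comm _ aY bY) as_; apply/eqP.
  by rewrite -dd dX // YY.
apply/inner_spaceP; exists s => x; apply/eqP; rewrite -subr_eq0; apply/eqP/ainj.
have := dd a x; rewrite (dY _ (brY x aY)) lact_br linearB /= -as_ => /addIr ->.
exact: subrr.
Qed.

End Vanishing.

End Derivations.

(** * Split chief factors *)

(** With a and b the components of x and y in a complement of an abelian ideal,
    this is the derivation identity for the projection onto that ideal. *)
Lemma br_comm_components (F : fieldType) (K : lieAlgebra F) (x y a b : K) :
  br (x - a) (y - b) = 0 -> br x y - br a b = br x (y - b) - br y (x - a).
Proof.
have Bl (u v w : K) : br (u - v) w = br u w - br v w.
  by rewrite (br_anti (u - v)) (br_anti u) (br_anti v) linearB opprB opprK addrC.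
rewrite Bl => /subr0_eq h.
rewrite (linearB (br y)) /= h (linearB (br a)) /=.
by rewrite (br_anti y x) (br_anti y a) opprB opprK addrACA subrr add0r addrC.
Qed.

Section Chief.
Variables (F : fieldType) (L : lieAlgebra F).

Lemma brDl (x y z : L) : br (x + y) z = br x z + br y z.
Proof. by rewrite br_anti linearD opprD -!br_anti. Qed.

Lemma brv_mem (U V : {vspace L}) x y : x \in U -> y \in V -> br x y \in brv U V.
Proof. by move=> xU yV; apply: mem_spanv; exists x, y. Qed.

Lemma brv_sub (U V W : {vspace L}) :
  (forall x y, x \in U -> y \in V -> br x y \in W) -> (brv U V <= W)%VS.
Proof. by move=> h; apply: spanv_sub => _ [x [y [xU yV ->]]]; exact: h. Qed.

(** If Y = X + [Y, Y], then Y is contained in the sum of X and any term of the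
    derived series. *)
Lemma solvable_factor_abelian (X Y : lieIdeal L) : lie_solvable L ->
  simple_factor X Y -> forall x y, x \in Y -> y \in Y -> br x y \in X.
Proof.
move=> [n solL] [XY nXY minY] x y xY yY.
have Yad z w : w \in Y -> br z w \in Y := @ls_stable _ _ _ Y z w.
have Xad z w : w \in X -> br z w \in X := @ls_stable _ _ _ X z w.
have YYad w z : z \in brv Y Y -> br w z \in brv Y Y.
  have h : linear_pred (fun u => br w u \in brv Y Y).
    by split=> [|a u v hu hv]; rewrite ?linear0 ?mem0v // linearP /= memvD ?memvZ.
  move: z; apply: (spanv_ind h) => _ [u [v [uY vY ->]]].
  rewrite -[br w _](subrK (br u (br w v))) -adj_br.
  by rewrite memvD ?brv_mem ?Yad // br_anti memvN Yad.
have sB z w : w \in (X + brv Y Y)%VS -> @lact _ _ (adj_mod L) z w \in (X + brv Y Y)%VS.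
  by move=> /memv_addP[u uX [v vY ->]]; rewrite linearD memv_add ?Xad ?YYad.
have YY : (brv Y Y <= Y)%VS by apply: brv_sub => u v _ vY; exact: Yad.
case: (minY (LieSubmodule sB)); first exact: addvSl.
- by rewrite subv_add XY.
- by move=> /= <-; apply: (subvP (addvSr _ _)); exact: brv_mem.
move=> /= defY; case: nXY; apply/eqP; rewrite eqEsubv XY /=.
suff : (Y <= X + iter n (fun U => brv U U) fullv)%VS by rewrite solL addv0.
elim: n {solL} => [|n IHn] /=; first exact: subv_trans (subvf _) (addvSr _ _).
rewrite -{1}defY subv_add addvSl; apply: brv_sub => u v.
move=> /(subvP IHn)/memv_addP[a aX [b bD ->]] /(subvP IHn)/memv_addP[c cX [d dD ->]].
rewrite brDl [br b _]linearD /= addrA memv_add ?brv_mem // memvD //; last exact: Xad.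
by rewrite br_anti memvN Xad.
Qed.

Section Split.
Variables (S : lieModule L) (I J : lieIdeal L).
Hypotheses (irrS : lie_irreducible S) (sIJ : simple_factor I J).

Definition split_factor : Prop :=
  [/\ abelian_sub (factor_in I J), lie_iso (subquot_mod I J) S & factor_splits I J].

Let IJ : (I <= J)%VS. Proof. by case: sIJ. Qed.

Lemma abelian_factorP : abelian_sub (factor_in I J) <->
  forall x y, x \in J -> y \in J -> br x y \in I.
Proof.
split=> [ab x y xJ yJ|h _ _ /memv_imgP[x xJ ->] /memv_imgP[y yJ ->]].
  rewrite -quotv_proj_eq0 -quot_brE; apply/eqP.
  by apply: ab; exact: memv_img.
by rewrite [br _ _]quot_brE; apply/eqP; rewrite quotv_proj_eq0 h.
Qed.

Lemma abelian_iso_acts_trivially : abelian_sub (factor_in I J) ->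
  lie_iso (subquot_mod I J) S -> acts_trivially S J.
Proof.
move=> /abelian_factorP ab /(iso_factor_hom sIJ)[g [hg ng _]] x xJ s.
have := memvf s; rewrite -(factor_hom_surj irrS hg ng) => /memv_imgP[y yJ ->].
by case: hg => gI gJ; rewrite -gJ // gI //; exact: ab.
Qed.

(** The kernel of a derivation that maps J / I isomorphically onto S is a
    complement of J / I. *)
Lemma split_of_der (d : 'Hom(L, S)) : acts_trivially S J -> derivation d ->
  (forall x, x \in I -> d x = 0) -> (exists2 y, y \in J & d y <> 0) -> split_factor.
Proof.
move=> tJ dd dI [y0 y0J dy0].
have hd : @factor_hom _ _ (adj_mod L) S I J d.
  by split=> // x y yJ; rewrite [LHS]dd [lact y _](tJ _ yJ) subr0.
have nd : ~ @kills _ _ (adj_mod L) S J d by move=> /(_ _ y0J).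
have dJ x : x \in J -> d x = 0 -> x \in I := factor_hom_inj sIJ hd nd (y := x).
split.
- apply/abelian_factorP => x y xJ yJ; apply: dJ; first exact: (@ls_stable _ _ _ J).
  by rewrite dd (tJ _ xJ) (tJ _ yJ) subr0.
- exact: (factor_hom_iso irrS sIJ hd nd).
have [r rP] := exists_section (factor_hom_surj irrS hd nd).
(* sg projects onto the kernel of d, along a section r of d with values in J *)
pose sg x := x - r (d x).
have dsg x : d (sg x) = 0.
  by rewrite /sg linearB /=; have [_ ->] := rP (d x); rewrite subrr.
have sgJ x : x - sg x \in J.
  by rewrite /sg opprB addrC subrK; case: (rP (d x)).
have lin_s : linear (fun z : quot_lie J => quotv_proj I (sg (quotv_repr J z)) : quot_lie I).
  move=> a u v; rewrite -linearP; congr (quotv_proj I _).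
  by rewrite /sg (linearP (quotv_repr J)) (linearP d) (linearP r) scalerBr opprD addrACA.
have [s sE] := linfunE lin_s.
have modI u v : d u = 0 -> d v = 0 -> u - v \in J -> quotv_proj I u = quotv_proj I v.
  move=> du dv uv; apply/eqP; rewrite quotv_proj_eq; apply: dJ => //.
  by rewrite linearB /= du dv subrr.
exists s.
  move=> u v; rewrite !sE [RHS]quot_brE.
  apply: modI; first exact: dsg.
    by rewrite dd !dsg !linear0 addr0.
  set x := quotv_repr J u; set y := quotv_repr J v; set z := quotv_repr J (br u v).
  have zxy : z - br x y \in J by exact: quotv_projK.
  have xyJ : br x y - br (sg x) (sg y) \in J.
    rewrite -[X in br X y](subrK (sg x)) brDl -addrA memvD //.
      by rewrite br_anti memvN; apply: (@ls_stable _ _ _ J).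
    by rewrite -linearB; apply: (@ls_stable _ _ _ J).
  rewrite -[_ - _](subrK (br x y - br (sg x) (sg y))) memvD //.
  rewrite opprB addrA subrK -[_ - _](subrK (z - br x y)) memvD //.
  by rewrite opprB addrA subrK -opprB memvN.
move=> z; rewrite sE /quotv_map comp_lfunE.
set x := quotv_repr J z.
rewrite -[RHS](quotv_reprK (W := J)) -/x; apply/eqP; rewrite quotv_proj_eq.
rewrite -[quotv_repr I _](subrK (sg x)) -addrA memvD //.
  by apply: (subvP IJ); exact: quotv_projK.
by rewrite -opprB memvN.
Qed.

(** The projection onto J / I along a complement, followed by the isomorphism
    with S, is a derivation because J / I is abelian. *)
Lemma der_of_split : split_factor ->
  exists d : 'Hom(L, S), [/\ derivation d, forall x, x \in I -> d x = 0 &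
    exists2 y, y \in J & d y <> 0].
Proof.
move=> [/abelian_factorP ab iso [s shom sK]].
have [g [[gI gJ] ng ginj]] := iso_factor_hom sIJ iso.
(* t x represents the component of x in J / I with respect to the complement
   s (L / J) *)
have lin_t : linear (fun x : L => quotv_repr I (quotv_proj I x - s (quotv_proj J x)) : L).
  move=> a u v; rewrite -linearP; congr (quotv_repr I _).
  rewrite (linearP (quotv_proj I)) (linearP (quotv_proj J)) (linearP s).
  by rewrite scalerBr opprD addrACA.
have [t tE] := linfunE lin_t.
have pt x : quotv_proj I (t x) = quotv_proj I x - s (quotv_proj J x).
  by rewrite tE quotv_reprK.
have mapIJ x : quotv_map I J (quotv_proj I x) = quotv_proj J x.
  rewrite /quotv_map comp_lfunE; apply/eqP; rewrite quotv_proj_eq.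
  by apply: (subvP IJ); exact: quotv_projK.
have tJ x : t x \in J.
  by rewrite -quotv_proj_eq0 -mapIJ pt linearB /= mapIJ [quotv_map _ _ _]sK subrr.
have tx x : x \in J -> t x - x \in I.
  move=> xJ; rewrite -quotv_proj_eq pt; have -> : quotv_proj J x = 0.
    by apply/eqP; rewrite quotv_proj_eq0.
  by rewrite linear0 subr0.
have gt u v : u \in J -> v \in J -> u - v \in I -> g u = g v.
  by move=> uJ vJ uv; apply/eqP; rewrite -subr_eq0 -linearB /= gI.
have Jad x y : y \in J -> br x y \in J := @ls_stable _ _ _ J x y.
exists (g \o t)%VF; split.
- move=> x y; rewrite !comp_lfunE -!gJ // -linearB /=.
  apply: gt => //; first by rewrite memvB ?Jad.
  have TT : br (quotv_proj I (t x) : quot_lie I) (quotv_proj I (t y)) = 0.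
    by rewrite [LHS]quot_brE; apply/eqP; rewrite quotv_proj_eq0 ab.
  rewrite -quotv_proj_eq pt linearB /= -!quot_brE.
  rewrite -[quot_br (quotv_proj J x) _]/(@br _ (quot_lie J) (quotv_proj J x) (quotv_proj J y)).
  rewrite shom !pt; move: TT; rewrite !pt.
  move: (quotv_proj I x : quot_lie I) (quotv_proj I y : quot_lie I) => X Y.
  by move=> TT; apply/eqP; exact: (br_comm_components TT).
- move=> x xI; rewrite comp_lfunE gI //; have xJ := subvP IJ _ xI.
  by rewrite -[t x](subrK x) memvD ?tx.
apply: contrapT => h; apply: ng => y yJ; apply: contrapT => gy; apply: h.
by exists y => //; rewrite comp_lfunE (gt _ y) // tx.
Qed.

End Split.
End Chief.

Section DimDer.
Variables (F : fieldType) (L : lieAlgebra F) (S : lieModule L).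
Hypotheses (solL : lie_solvable L) (irrS : lie_irreducible S).
Variables (m : nat) (I : nat -> lieIdeal L).
Hypothesis (hI : chief_series m I).

Let sI j : (j < m)%N -> simple_factor (I j) (I j.+1).
Proof. by case: hI => _ _ h /h[sub mi]; exact: chief_simple_factor. Qed.

Let leI i j : (i <= j)%N -> (j <= m)%N -> (I i <= I j)%VS.
Proof.
move=> /subnKC<-; elim: (j - i)%N => [|k IHk]; rewrite ?addn0 // addnS => ltkm.
by apply: subv_trans (IHk (ltnW ltkm)) _; case: (sI ltkm).
Qed.

Let good j := `[< split_factor S (I j) (I j.+1) >].

Lemma der_step j : (j < m)%N -> acts_trivially S (I j.+1) ->
  \dim (der_space S (I j)) =
  (\dim (der_space S (I j.+1)) + good j * \dim (end_space S))%N.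
Proof.
move=> ltjm tJ; have sIJ := sI ltjm; have [IJ _ _] := sIJ.
rewrite (@filtration_step _ _ (adj_mod L) S (I j) (I j.+1) irrS sIJ
  (der_space S (I j)) (der_space S (I j.+1))) => [|d|phi d|d].
- congr (_ + nat_of_bool _ * _)%N; apply/asbool_equiv_eq; split.
    move=> [d /der_spaceP[dd dI] nd]; apply: (split_of_der irrS sIJ tJ dd dI).
    apply: contrapT => h; apply: nd => y yJ; apply: contrapT => dy; apply: h.
    by exists y.
  move=> /(der_of_split sIJ)[d [dd dI [y yJ dy]]]; exists d.
    exact/der_spaceP.
  by move=> /(_ y yJ).
- move=> /der_spaceP[dd dI]; split=> // x y yJ.
  by rewrite [LHS]dd [lact y _](tJ _ yJ) subr0.
- move=> /end_spaceP phiL /der_spaceP[dd dI]; apply/der_spaceP.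
  split=> [x y|x xI]; first by rewrite !comp_lfunE dd linearB /= !phiL.
  by rewrite comp_lfunE dI // linear0.
split=> [/der_spaceP[dd dJ]|[/der_spaceP[dd dI] kd]]; last exact/der_spaceP.
split=> //; apply/der_spaceP; split=> // x xI; exact/dJ/(subvP IJ).
Qed.

(** Derivations vanishing on the largest term of the series that acts trivially
    on S are inner, and no chief factor above that term counts, since a factor
    that counts acts trivially on S.  The proof descends from the top of the
    series. *)
Lemma dim_der_space j : (j <= m)%N -> acts_trivially S (I j) ->
  \dim (der_space S (I j)) =
  ((\sum_(j <= i < m) good i) * \dim (end_space S) + \dim (inner_space S))%N.
Proof.
move=> /subnKC; move: (m - j)%N => k; elim: k j => [|k IHk] j.
  rewrite addn0 => -> tI; rewrite big_geq // mul0n add0n.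
  have [_ Im _] := hI.
  have i0 : inner_space S = 0%VS.
    apply/eqP; rewrite -subv0; apply/subvP => d /inner_spaceP[s ds].
    by rewrite memv0; apply/eqP/lfunP => x; rewrite lfunE ds tI // Im memvf.
  suff -> : der_space S (I m) = 0%VS by rewrite i0.
  apply/eqP; rewrite -subv0; apply/subvP => d /der_spaceP[_ dI].
  by rewrite memv0; apply/eqP/lfunP => x; rewrite lfunE dI // Im memvf.
move=> def_m tI; have ltjm : (j < m)%N by rewrite -def_m -addSnnS leq_addr.
have [tJ|ntJ] := asboolP (acts_trivially S (I j.+1)).
  rewrite der_step // IHk ?addSnnS //.
  by rewrite (big_ltn ltjm) mulnDl addnAC (addnC (_ * _)%N).
rewrite big_nat_cond big1 => [|i /andP[/andP[leji ltim] _]]; last first.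
  apply/eqP; rewrite eqb0; apply/asboolPn => -[ab iso _]; apply: ntJ => x xJ s.
  apply: (abelian_iso_acts_trivially irrS (sI ltim) ab iso).
  by apply: (subvP (@leI j.+1 i.+1 _ ltim)).
rewrite mul0n add0n; congr (\dim _); apply/eqP; rewrite eqEsubv inner_der // andbT.
apply/subvP => d /der_spaceP[dd dI].
apply: (der_inner irrS tI ntJ) => //.
exact: (solvable_factor_abelian solL (sI ltjm)).
Qed.

Theorem dim_derivations : \dim (der_space S 0%VS) =
  (split_mult m I S * \dim (end_space S) + \dim (inner_space S))%N.
Proof.
have [I0 _ _] := hI; have t0 : acts_trivially S (I 0%N).
  by move=> x; rewrite I0 memv0 => /eqP-> s; rewrite lact0l.
rewrite -I0 dim_der_space //; congr (_ * _ + _)%N; apply/esym.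
exact: (card_set_sum m good).
Qed.

End DimDer.

(** * Homomorphisms from the radical layer *)

Section Homs.
Variables (F : fieldType) (L : lieAlgebra F) (M S : lieModule L).

Lemma hom_lin (X : {vspace M}) : linear_pred (fun f : 'Hom(M, S) =>
  (forall x m, f (lact x m) = lact x (f m)) /\ forall m, m \in X -> f m = 0).
Proof.
split; first by split=> [x m|m _]; rewrite !zero_lfunE // linear0.
move=> a f g [fL fX] [gL gX]; split=> [x m|m mX]; rewrite !add_lfunE !scale_lfunE.
  by rewrite fL gL lact_linr.
by rewrite fX // gX // scaler0 addr0.
Qed.

Definition hom_space (X : {vspace M}) : {vspace 'Hom(M, S)} := vspace_of (@hom_lin X).

Lemma hom_spaceP X f : f \in hom_space X <->
  (forall x m, f (lact x m) = lact x (f m)) /\ forall m, m \in X -> f m = 0.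
Proof. exact: mem_vspace_of. Qed.

Definition complemented : Prop := forall N : lieSubmodule M,
  exists K : lieSubmodule M, (N + K = fullv)%VS /\ (N :&: K = 0)%VS.

Hypotheses (irrS : lie_irreducible S) (cM : complemented).

(** Along a complement of Y, a homomorphism defined on Y / X extends to M. *)
Lemma extend_factor_hom (X Y : lieSubmodule M) (g : 'Hom(M, S)) : (X <= Y)%VS ->
  factor_hom X Y g ->
  exists2 f, f \in hom_space X & forall y, y \in Y -> f y = g y.
Proof.
move=> XY [gX gY]; have [K [YK YK0]] := cM Y.
pose q := daddv_pi Y K; pose q' := daddv_pi K Y.
have KY0 : (K :&: Y = 0)%VS by rewrite capvC.
have qE v : q v + q' v = v by apply: daddv_pi_add => //; rewrite YK memvf.
have q_uniq y k : y \in Y -> k \in K -> q (y + k) = y.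
  move=> yY kK; rewrite linearD /= [q y]daddv_pi_id //.
  suff -> : q k = 0 by rewrite addr0.
  apply/eqP; rewrite -memv0 -YK0 memv_cap memv_pi /=.
  by rewrite -[q k](addrK (q' k)) qE memvB // memv_pi.
exists (g \o q)%VF => [|y yY]; last by rewrite comp_lfunE [q y]daddv_pi_id.
apply/hom_spaceP; split=> [x m|m mX]; rewrite !comp_lfunE; last first.
  by rewrite [q m]daddv_pi_id ?gX // (subvP XY).
rewrite -gY ?memv_pi //; congr (g _); rewrite -{1}[m]qE linearD /= q_uniq //.
  by apply: ls_stable; exact: memv_pi.
by apply: ls_stable; exact: memv_pi.
Qed.

(** Filter the homomorphisms by the terms of the series on which they vanish;
    semisimplicity makes a step non-zero as soon as the factor is isomorphic
    to S. *)
Lemma dim_hom_space (n : nat) (N : nat -> lieSubmodule M) : composition_series n N ->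
  \dim (hom_space 0%VS) = (composition_mult n N S * \dim (end_space S))%N.
Proof.
move=> [N0 Nn hN]; pose good i := `[< lie_iso (subquot_mod (N i) (N i.+1)) S >].
have step i : (i < n)%N -> \dim (hom_space (N i)) =
    (\dim (hom_space (N i.+1)) + good i * \dim (end_space S))%N.
  move=> /hN[sub irr]; have sXY := irreducible_simple_factor sub irr.
  have homf f : f \in hom_space (N i) -> factor_hom (N i) (N i.+1) f.
    by move=> /hom_spaceP[fL fX].
  rewrite (filtration_step (H := hom_space (N i)) (H' := hom_space (N i.+1)) irrS sXY) //.
  - congr (_ + nat_of_bool _ * _)%N; apply/asbool_equiv_eq; split.
      by move=> [f /homf hf nf]; exact: (factor_hom_iso irrS sXY hf nf).
    move=> /(iso_factor_hom sXY)[g [hg ng _]].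
    have [f fH fg] := extend_factor_hom sub hg; exists f => // kf.
    by apply: ng => y yY; rewrite -fg // kf.
  - move=> phi f /end_spaceP phiL /hom_spaceP[fL fX]; apply/hom_spaceP.
    split=> [x m|m mX]; first by rewrite !comp_lfunE fL phiL.
    by rewrite comp_lfunE fX // linear0.
  move=> f; split=> [/hom_spaceP[fL fY]|[/hom_spaceP[fL fX] kf]]; last exact/hom_spaceP.
  by split=> //; apply/hom_spaceP; split=> // m mX; exact/fY/(subvP sub).
have main k j : (j + k)%N = n -> \dim (hom_space (N j)) =
    ((\sum_(j <= i < n) good i) * \dim (end_space S))%N.
  elim: k j => [|k IHk] j def_n.
    rewrite addn0 in def_n; rewrite def_n big_geq // mul0n.
    apply/eqP; rewrite dimv_eq0 -subv0; apply/subvP => f /hom_spaceP[_ fN].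
    by rewrite memv0; apply/eqP/lfunP => m; rewrite lfunE fN // Nn memvf.
  have ltjn : (j < n)%N by rewrite -def_n -addSnnS leq_addr.
  by rewrite step // IHk ?addSnnS // (big_ltn ltjn) mulnDl addnC.
rewrite -N0 (main n) //; congr (_ * _)%N; apply/esym.
exact: (card_set_sum n good).
Qed.

End Homs.

Section Restricted.
Variables (F : fieldType) (p : nat) (L : restrictedLieAlgebra F p).

Lemma restricted_factor (M : lieModule L) (X Y : lieSubmodule M) :
  restricted_module M -> restricted_module (subquot_mod X Y).
Proof.
move=> rM x u; have [m mY ->] := factor_proj_surj u.
suff iterE k : iter k (lact x) m \in Y /\
    factor_proj X Y (iter k (lact x) m) = iter k (lact x) (factor_proj X Y m).
  by rewrite -factor_proj_act // rM; case: (iterE p).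
elim: k => //= k [kY kE]; split; first exact: ls_stable.
by rewrite factor_proj_act // kE.
Qed.

Variable U : restrictedEnvelope L.

Variable P : algModule U.
Let X := res_submod (alg_submodule_actv (M := P) (left_ideal_Jac2 (A := U))).
Let Y := res_submod (alg_submodule_actv (M := P) (left_ideal_Jac (A := U))).

(** The layer is a u(L)-module on which Jac u(L) acts as 0. *)
Lemma radical_layer_complemented : complemented (radical_layer P).
Proof.
have [d0|d0] := posnP (\dim {:radical_layer P}).
  have all0 (W : {vspace radical_layer P}) : W = 0%VS.
    by apply/eqP; rewrite -dimv_eq0 -leqn0 -d0 dimvS ?subvf.
  by move=> N; exists N; split; rewrite [LHS]all0 // [RHS]all0.
have rR : restricted_module (radical_layer P).
  exact: restricted_factor (@restricted_res_mod F p L U P).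
pose R := alg_of_restricted U rR d0; have hact := alg_of_restrictedE U rR d0.
have actE (u : U) (m : P) : m \in Y ->
    factor_proj X Y (aact u m) = @aact F U R u (factor_proj X Y m).
  move: u m; apply: env_ind.
  - split=> [m mY|a u v uE vE m mY]; first by rewrite !aact0l linear0.
    by rewrite !aact_linl linearP /= uE // vE.
  - by move=> m mY; rewrite !aact1.
  move=> x u uE m mY; rewrite !aactM [RHS]hact -uE //.
  apply: (@factor_proj_act _ _ (res_mod P) X Y x (aact u m)).
  exact: alg_submodule_actv (@left_ideal_Jac F U) u m mY.
have JR : actv R (Jac U) = 0%VS.
  apply/eqP; rewrite -subv0; apply: spanv_sub => _ [a [v [aJ ->]]].
  have [m mY ->] := factor_proj_surj (v : radical_layer P).
  rewrite -[aact a _](actE a m mY) memv0 factor_proj_eq0; last first.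
    exact: alg_submodule_actv (@left_ideal_Jac F U) a m mY.
  have h : linear_pred (fun m : P => aact a m \in X).
    by split=> [|c u w uX wX]; rewrite ?linear0 ?mem0v // linearP memvD ?memvZ.
  move: m mY; apply: (spanv_ind h) => _ [b [m [bJ ->]]].
  by rewrite -aactM; apply: mem_actv; exact: memv_mul.
move=> N; have sN : @alg_submodule F U R N.
  apply: alg_submodule_of_lie => x m mN.
  by rewrite [aact _ _]hact; exact: ls_stable.
have [K [sK KN]] := supplement_mod_Jac sN; rewrite JR => K0.
have sK' x (m : radical_layer P) : m \in (K : {vspace R}) -> lact x m \in (K : {vspace R}).
  by move=> mK; rewrite -hact; exact: sK.
exists (@LieSubmodule _ _ (radical_layer P) K sK'); split; first by rewrite addvC.
by apply/eqP; rewrite -subv0 capvC.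
Qed.

End Restricted.

(** * Restricted derivations and the projective cover *)

Section RestrictedDerivations.
Variables (F : fieldType) (p : nat) (L : restrictedLieAlgebra F p) (S : lieModule L).

Lemma iter_lact_lin (M : lieModule L) x n : linear (iter n (@lact F L M x)).
Proof. by elim: n => [|n IHn] a u v //=; rewrite IHn lact_linr. Qed.

Definition restricted_der (d : 'Hom(L, S)) : Prop :=
  forall x, d (rl_pmap x) = iter p.-1 (lact x) (d x).

Lemma rder_lin :
  linear_pred (fun d : 'Hom(L, S) => derivation d /\ restricted_der d).
Proof.
have i0 x n : iter n (lact x) 0 = 0 :> S by elim: n => //= n ->; rewrite linear0.
split=> [|a d e [dd rd] [de re]].
  by split=> [x y|x]; rewrite !zero_lfunE ?i0 // !linear0 addr0.
split=> [x y|x]; rewrite !add_lfunE !scale_lfunE.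
  by rewrite dd de !lact_linr scalerBr opprD addrACA.
by rewrite rd re iter_lact_lin.
Qed.

Definition rder_space : {vspace 'Hom(L, S)} := vspace_of rder_lin.

Lemma rder_spaceP d : d \in rder_space <-> derivation d /\ restricted_der d.
Proof. exact: mem_vspace_of. Qed.

(** The module S (+) F on which x acts by (s, c) |-> (x s + c d(x), 0): the
    extension of the trivial module by S that d defines. *)
Section Extension.
Variables (d : 'Hom(L, S)) (dd : derivation d).

Definition ext_act (x : L) (v : (S * F^o)%type) : (S * F^o)%type :=
  (lact x v.1 + (v.2 : F) *: d x, 0).

Lemma ext_linl v : linear (ext_act^~ v).
Proof.
move=> a x y; congr pair; last by rewrite /= scaler0 addr0.
by rewrite /= lact_linl linearP /= !scalerDr !scalerA (mulrC _ a) addrACA.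
Qed.

Lemma ext_linr x : linear (ext_act x).
Proof.
move=> a u v; congr pair; last by rewrite /= scaler0 addr0.
by rewrite /= lact_linr scalerDl !scalerDr !scalerA addrACA.
Qed.

Lemma ext_br x y v : ext_act (br x y) v = ext_act x (ext_act y v) - ext_act y (ext_act x v).
Proof.
congr pair; last by rewrite /= subr0.
rewrite /= !scale0r !addr0 dd lact_br scalerBr.
have lactZ z a (s : S) : lact z (a *: s) = a *: lact z s by exact: linearZ.
rewrite (linearD (lact x)) (linearD (lact y)) /= !lactZ.
by rewrite opprD addrACA.
Qed.

Definition ext_mod : lieModule L := LieModule ext_linl ext_linr ext_br.

Lemma ext_iter n x v : iter n.+1 (@lact F L ext_mod x) v =
  (iter n.+1 (lact x) v.1 + v.2 *: iter n (lact x) (d x), 0).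
Proof.
elim: n => // n IHn; rewrite iterS IHn; congr pair.
by rewrite /= scale0r addr0 linearD /= linearZ.
Qed.

End Extension.
End RestrictedDerivations.

Section ProjectiveCover.
Variables (F : fieldType) (p : nat) (hp : prime p) (L : restrictedLieAlgebra F p).
Variables (U : restrictedEnvelope L).
Variables (T : algModule U) (hT : lie_iso (res_mod T) (triv_mod L)).
Variables (P : algModule U) (pi : 'Hom(P, T)) (hP : projective_cover pi).
Variables (S : lieModule L).
Hypotheses (irrS : lie_irreducible S) (rS : restricted_module S).

Let X := res_submod (alg_submodule_actv (M := P) (left_ideal_Jac2 (A := U))).
Let Y := res_submod (alg_submodule_actv (M := P) (left_ideal_Jac (A := U))).

Lemma dim_irreducible_gt0 : (0 < \dim {:S})%N.
Proof. by case: irrS => d0 _; rewrite lt0n. Qed.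

Let SU := alg_of_restricted U rS dim_irreducible_gt0.

Lemma Jac_kills_S a (s : SU) : a \in Jac U -> aact a s = 0.
Proof.
apply: Jac_kills_simple => N sN.
have sN' x (v : S) : v \in (N : {vspace S}) -> lact x v \in (N : {vspace S}).
  by move=> vN; rewrite -(alg_of_restrictedE U rS dim_irreducible_gt0); exact: sN.
by case: irrS => _ /(_ (LieSubmodule sN')).
Qed.

Lemma Jac_kills_irreducible (V : algModule U) : lie_irreducible (res_mod V) ->
  forall a (v : V), a \in Jac U -> aact a v = 0.
Proof.
move=> [_ irr]; apply: Jac_kills_simple => N sN.
exact: (irr (res_submod sN)).
Qed.

Lemma irreducible_triv : lie_irreducible (res_mod T).
Proof.
have dT : \dim {:T} = 1%N by rewrite [LHS](lie_iso_dim hT) dimvf.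
split=> [|N]; first by rewrite [\dim _]dT.
have [->|N0] := eqVneq (N : {vspace T}) 0%VS; [by left|right].
by apply/eqP; rewrite eqEdim subvf /= [\dim {:_}]dT lt0n dimv_eq0.
Qed.

(** The kernel of the projective cover is superfluous, and P / (Jac P) is
    semisimple. *)
Lemma lker_cover : lker pi = Y.
Proof.
have [_ homp _ sup] := hP; apply/eqP; rewrite eqEsubv; apply/andP; split.
  have sk : alg_submodule (lker pi).
    by move=> a m; rewrite !memv_ker homp => /eqP->; rewrite linear0.
  have [K [sK KP KJ]] := supplement_mod_Jac sk.
  by move: KJ; rewrite (sup K) // ?capfv // addvC.
apply: spanv_sub => _ [a [m [aJ ->]]]; rewrite memv_ker homp.
by rewrite Jac_kills_irreducible //; exact: irreducible_triv.
Qed.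

(** P -> T read as an augmentation tau of P, with kernel Jac P, and a vector m0
    of augmentation 1. *)
Lemma cover_augmentation : exists (tau : 'Hom(P, F^o)) (m0 : P),
  [/\ forall x m, tau (aact (env_inj U x) m) = 0, tau m0 = 1,
      forall m, (tau m == 0) = (m \in Y) &
      forall v : T, exists c : F, v = c *: pi m0].
Proof.
have [f bij_f fL] := hT; have [_ homp surj _] := hP.
have [t ft] : exists t : T, f t = (1 : F^o) by case: bij_f => g _ gK; exists (g 1).
have [m0 _ pm0] : exists2 m0, m0 \in fullv & t = pi m0.
  by apply/memv_imgP; rewrite surj memvf.
exists (f \o pi)%VF, m0; split=> [x m||m|v].
- by rewrite comp_lfunE homp [f _]fL.
- by rewrite comp_lfunE -pm0.
- rewrite comp_lfunE -lker_cover memv_ker.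
  by rewrite -(inj_eq (bij_inj bij_f)) linear0.
by exists (f v : F); apply: (bij_inj bij_f); rewrite linearZ /= -pm0 ft [RHS]mulr1.
Qed.

Let proj := factor_proj X Y.

Let projL (x : L) m : m \in Y -> proj (aact (env_inj U x) m) = lact x (proj m).
Proof. exact: (@factor_proj_act _ _ (res_mod P) X Y). Qed.

Lemma iter_lact_restricted (V : lieModule L) x (v : V) : restricted_module V ->
  lact (rl_pmap x) v = iter p.-1 (lact x) (lact x v).
Proof. by move=> rV; rewrite rV -iterSr prednK ?prime_gt0. Qed.

(** If x |-> f (x m0) is inner, then f extends from Jac P to P; but a
    homomorphism from P to the simple module S kills Jac P. *)
Lemma inner_hom_eq0 (f : 'Hom(radical_layer P, S)) (m0 : P) (tau : 'Hom(P, F^o)) (s : S) :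
  (forall x m, tau (aact (env_inj U x) m) = 0) -> tau m0 = 1 ->
  (forall m, (tau m == 0) = (m \in Y)) ->
  (forall x v, f (lact x v) = lact x (f v)) ->
  (forall x, f (proj (aact (env_inj U x) m0)) = lact x s) -> f = 0.
Proof.
move=> tauL tau0 tauY fL f_inner.
have hact := alg_of_restrictedE U rS dim_irreducible_gt0.
pose h m := f (proj m).
(* h' extends h from Jac P to P by sending m0 to s *)
pose h' m := h (m - tau m *: m0) + tau m *: s.
have lin_h : linear h by move=> a u v; rewrite /h !linearP.
have resY m : m - tau m *: m0 \in Y.
  by rewrite -tauY linearB linearZ /= tau0 [_ *: _]mulr1 subrr.
have h0 m : m \in Y -> h' m = h m.
  by rewrite -tauY => /eqP t0; rewrite /h' t0 !scale0r subr0 addr0.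
have LY x m : aact (env_inj U x) m \in Y by rewrite -tauY tauL.
have lin_h' : linear (h' : P -> SU).
  move=> a u v; rewrite /h' (linearP tau) scalerDl opprD addrACA -scalerA -scalerBr.
  by rewrite lin_h scalerDl -scalerA scalerDr addrACA.
have h'L x m : h' (aact (env_inj U x) m) = @aact F U SU (env_inj U x) (h' m).
  rewrite h0 // [RHS]hact /h' (linearD (lact x)) /= (_ : lact x (h _) =
    h (aact (env_inj U x) (m - tau m *: m0))); last by rewrite /h projL // fL.
  have aZ (u : U) c (v : P) : aact u (c *: v) = c *: aact u v by exact: linearZ.
  have lZ c (v : S) : lact x (c *: v) = c *: lact x v by exact: linearZ.
  rewrite linearB /= aZ.
  have hB u v : h (u - v) = h u - h v by rewrite -scaleN1r addrC lin_h scaleN1r addrC.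
  have hZ a u : h (a *: u) = a *: h u by rewrite /h !linearZ.
  by rewrite hB hZ lZ -f_inner -/(h _) subrK.
have h'U := alg_hom_of_lie lin_h' h'L.
apply/lfunP => v; have [m mY def_v] := factor_proj_surj v.
have -> : f v = h m by rewrite /h def_v.
rewrite lfunE /=.
have hlin : linear_pred (fun m => h' m = 0).
  split; first by rewrite /h' /h !linear0 scale0r subr0 !linear0 scale0r addr0.
  by move=> a u w hu hw; rewrite lin_h' hu hw scaler0 addr0.
rewrite -h0 //; clear def_v; move: m mY; apply: (spanv_ind hlin) => _ [a [m [aJ ->]]].
by rewrite h'U Jac_kills_S.
Qed.

(** A restricted derivation d defines an extension S (+) F of the trivial
    module; lifting P -> T to it gives a homomorphism from Jac P to S. *)
Lemma rder_lift (d : 'Hom(L, S)) (m0 : P) (tau : 'Hom(P, F^o)) :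
  (forall x m, tau (aact (env_inj U x) m) = 0) -> tau m0 = 1 ->
  (forall m, (tau m == 0) = (m \in Y)) ->
  (forall v : T, exists c : F, v = c *: pi m0) ->
  derivation d -> restricted_der d ->
  exists (f : 'Hom(radical_layer P, S)) (s : S),
    (forall x v, f (lact x v) = lact x (f v)) /\
    (forall x, f (proj (aact (env_inj U x) m0)) = d x + lact x s).
Proof.
move=> tauL tau0 tauY spanT dd rd.
have rE : restricted_module (ext_mod dd).
  have def_p := prednK (prime_gt0 hp) => x v.
  suff: lact (rl_pmap x) v = iter p.-1.+1 (lact x) v by rewrite def_p.
  by rewrite ext_iter def_p /= /ext_act rS rd.
have dE : (0 < \dim {:ext_mod dd})%N.
  rewrite lt0n dimv_eq0; apply/eqP => /(congr1 (fun V : {vspace ext_mod dd} => ((0, 1) : ext_mod dd) \in V)).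
  by rewrite memvf memv0 => /esym/eqP[/eqP]; rewrite oner_eq0.
pose EU := alg_of_restricted U rE dE; have hact := alg_of_restrictedE U rE dE.
have hsact := alg_of_restrictedE U rS dim_irreducible_gt0.
pose i (s : SU) : EU := (s : S, 0 : F^o).
have lin_i : linear i.
  by move=> a u v; congr pair; rewrite /= scaler0 addr0.
have iU : forall u s, i (aact u s) = aact u (i s).
  apply: (alg_hom_of_lie lin_i) => x s; rewrite hsact hact.
  by rewrite /i /= /ext_act /= scale0r addr0.
have JE a (s : S) : a \in Jac U -> @aact F U EU a (s, 0) = 0.
  by move=> aJ; rewrite -[LHS](iU a s) Jac_kills_S.
have lin_g : linear (fun v : EU => v.2 *: pi m0 : T).
  by move=> a u v; rewrite /= scalerDl -scalerA.
have [g gE] := linfunE lin_g.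
have [projP homp _ _] := hP.
have LY x m : aact (env_inj U x) m \in Y by rewrite -tauY tauL.
have piY m : (m \in Y) = (pi m == 0) by rewrite -lker_cover memv_ker.
have g_hom : alg_hom g.
  apply: (alg_hom_of_lie (f := g)) => [a u v|x v]; first exact: linearP.
  have aZ (u : U) c (t : T) : aact u (c *: t) = c *: aact u t by exact: linearZ.
  rewrite hact !gE /= scale0r aZ -homp.
  by have /eqP-> : pi (aact (env_inj U x) m0) == 0; rewrite -?piY ?scaler0.
have g_surj : limg g = fullv.
  apply/eqP; rewrite eqEsubv subvf; apply/subvP => t _; have [c ->] := spanT t.
  by apply/memv_imgP; exists ((0, c) : EU); rewrite ?memvf ?gE.
have [q q_hom gq] := projP _ _ _ _ g_hom g_surj homp.
(* q lifts pi, so that it maps m0 to some (s, 1) and Jac P into S (+) 0 *)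
have q2 m : (q m).2 *: pi m0 = pi m.
  have <- : (g \o q)%VF m = pi m by rewrite gq.
  by rewrite comp_lfunE gE.
have pi0 : pi m0 != 0 by rewrite -piY -tauY tau0 oner_eq0.
have q2Y m : m \in Y -> (q m).2 = 0.
  rewrite piY => /eqP m0'; have /eqP := q2 m.
  by rewrite m0' scaler_eq0 (negbTE pi0) orbF => /eqP.
have q21 : (q m0).2 = 1.
  have /eqP := q2 m0; rewrite -subr_eq0 -{2}[pi m0]scale1r -scalerBl scaler_eq0.
  by rewrite (negbTE pi0) orbF subr_eq0 => /eqP.
have lin_h : linear (fun m : P => (q m).1 : S) by move=> a u v; rewrite linearP.
have [h hE] := linfunE lin_h.
have qE m : m \in Y -> q m = (h m, 0).
  by move=> mY; rewrite hE -(q2Y m mY); case: (q m).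
have hX m : m \in X -> h m = 0.
  have lh : linear_pred (fun m => h m = 0).
    by split=> [|c u v hu hv]; rewrite ?linear0 // linearP /= hu hv scaler0 addr0.
  move: m; apply: (spanv_ind lh) => _ [u [m [uJ ->]]].
  have lu : linear_pred (fun u : U => h (aact u m) = 0).
    split=> [|c v w hv hw]; first by rewrite aact0l linear0.
    by rewrite aact_linl linearP /= hv hw scaler0 addr0.
  suff /subvP/(_ u uJ)/mem_vspace_of : (Jac U * Jac U <= vspace_of lu)%VS by [].
  apply/prodvP => a b aJ bJ; apply/mem_vspace_of.
  rewrite hE aactM q_hom qE; last exact: mem_actv.
  by rewrite JE.
have [f fE] := exists_factor_map Y hX.
exists f, (q m0).1; split=> [x v|x].
  have [m mY ->] := factor_proj_surj v.
  rewrite -[lact x _]projL // !fE // hE q_hom hact qE //=.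
  by rewrite scale0r addr0.
by rewrite fE // hE q_hom hact /= q21 scale1r addrC.
Qed.

(** Ext^1(F, S) = Hom(Jac P / Jac^2 P, S) as the restricted derivations modulo
    the inner ones: f corresponds to the derivation x |-> f (x m0), for m0 in P
    over a generator of the trivial module. *)
Lemma dim_rder_space : \dim (rder_space S) =
  (\dim (hom_space S (0%VS : {vspace radical_layer P})) + \dim (inner_space S))%N.
Proof.
have [tau [m0 [tauL tau0 tauY spanT]]] := cover_augmentation.
have LY x m : aact (env_inj U x) m \in Y by rewrite -tauY tauL.
have [a aE] := linfunE (@lact_linl _ _ (res_mod P) m0).
have [psi psiE] : exists psi : 'Hom('Hom(radical_layer P, S), 'Hom(L, S)),
    forall f, psi f = (f \o (proj \o a))%VF.
  apply: (@linfunE _ _ _ (fun f : 'Hom(radical_layer P, S) => (f \o (proj \o a))%VF)).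
  by move=> k u v; rewrite comp_lfunDl comp_lfunZl.
have psiP f x : psi f x = f (proj (aact (env_inj U x) m0)).
  by rewrite psiE !comp_lfunE [a x]aE.
set H := hom_space S _.
have key f : f \in H -> psi f \in inner_space S -> f = 0.
  move=> /hom_spaceP[fL _] /inner_spaceP[s fs].
  by apply: (inner_hom_eq0 tauL tau0 tauY fL (s := s)) => x; rewrite -psiP.
have psi_inj : (H :&: lker psi = 0)%VS.
  apply/eqP; rewrite -subv0; apply/subvP => f; rewrite memv_cap memv_ker memv0.
  by move=> /andP[fH /eqP f0]; rewrite (key f) // f0 mem0v.
rewrite -(limg_dim_eq psi_inj) -dimv_disjoint_sum; last first.
  apply/eqP; rewrite -subv0; apply/subvP => d; rewrite memv_cap memv0.
  by move=> /andP[/memv_imgP[f fH ->] /(key f fH) ->]; rewrite linear0.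
congr (\dim _); apply/eqP; rewrite eqEsubv; apply/andP; split.
  apply/subvP => d /rder_spaceP[dd rd].
  have [f [s [fL fd]]] := rder_lift tauL tau0 tauY spanT dd rd.
  rewrite -[d](addrK (inner s)) memv_add //.
    apply/memv_imgP; exists f.
      by apply/hom_spaceP; split=> // m; rewrite memv0 => /eqP->; rewrite linear0.
    by apply/lfunP => x; rewrite add_lfunE innerE psiP fd.
  by rewrite memvN; apply/inner_spaceP; exists s => x; rewrite innerE.
rewrite subv_add; apply/andP; split.
  apply/subvP => _ /memv_imgP[f /hom_spaceP[fL _] ->]; apply/rder_spaceP.
  split=> [x y|x]; rewrite !psiP.
    rewrite -!fL -!projL // -!linearB /=; congr (f (proj _)).
    exact: (res_br (M := P)).
  pose v0 : res_mod P := aact (env_inj U x) m0.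
  have -> : aact (env_inj U (rl_pmap x)) m0 = iter p.-1 (lact x) v0.
    exact: (@iter_lact_restricted (res_mod P) x m0 (@restricted_res_mod _ _ _ U P)).
  rewrite -[aact _ _]/v0; elim: p.-1 => // k IHk; rewrite !iterS -IHk -fL.
  congr (f _); apply: projL.
  by case: k {IHk} => [|k]; rewrite ?iterS; exact: LY.
apply/subvP => d /inner_spaceP[s ds]; apply/rder_spaceP.
by split=> [x y|x]; rewrite !ds ?lact_br // iter_lact_restricted.
Qed.

End ProjectiveCover.

(** * Ordinary and restricted derivations *)

Section Frobenius.
Variables (F : fieldType) (L : lieAlgebra F) (M : lieModule L).

(** Leibniz' rule for the commutation of x^n past y. *)
Lemma iter_lact_lact n (x y : L) (m : M) : iter n (lact x) (lact y m) =
  \sum_(k < n.+1) lact (iter k (br x) y) (iter (n - k) (lact x) m) *+ 'C(n, k).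
Proof.
elim: n => [|n IHn]; first by rewrite big_ord1.
rewrite iterS IHn linear_sum /=.
have step k : (k <= n)%N ->
    lact x (lact (iter k (br x) y) (iter (n - k) (lact x) m) *+ 'C(n, k)) =
    lact (iter k.+1 (br x) y) (iter (n - k) (lact x) m) *+ 'C(n, k) +
    lact (iter k (br x) y) (iter (n.+1 - k) (lact x) m) *+ 'C(n, k).
  move=> lekn; rewrite -mulrnDl subSn // raddfMn /=; congr (_ *+ _).
  by rewrite lact_br subrK.
rewrite (eq_bigr _ (fun (k : 'I_n.+1) _ => step k (leq_ord k))).
rewrite big_split /= [RHS]big_ord_recl bin0 subn0 mulr1n.
under [in RHS]eq_bigr => k _ do rewrite lift0 binS mulrnDr subSS.
rewrite [in RHS]big_split addrA addrC; congr (_ + _).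
rewrite [LHS]big_ord_recl bin0 subn0 mulr1n; congr (_ + _).
rewrite [RHS]big_ord_recr /= bin_small // mulr0n addr0.
by apply: eq_bigr => k _; rewrite /bump leq0n add1n subSS.
Qed.

(** In characteristic p all the intermediate terms of Leibniz' rule vanish. *)
Lemma iter_char_lact p (x y : L) (m : M) : p \in [pchar F] ->
  iter p (lact x) (lact y m) =
  lact (iter p (br x) y) m + lact y (iter p (lact x) m).
Proof.
move=> hp; have pr := pcharf_prime hp; have := prime_gt0 pr.
case: p hp pr => // n hp pr _.
rewrite iter_lact_lact big_ord_recl big_ord_recr /= bin0 ?subn0 /bump /= add1n binn subnn.
rewrite big1 ?add0r 1?addrC // => k _; rewrite add1n -scaler_nat.
have /eqP-> : ('C(n.+1, k.+1)%:R == 0 :> F).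
  by rewrite -(dvdn_pcharf hp) prime_dvd_bin //= ltnS.
by rewrite scale0r.
Qed.

End Frobenius.

Section Trivial.
Variables (F : fieldType) (L : lieAlgebra F) (S : lieModule L).

(** A non-zero invariant vector would span S. *)
Lemma nontrivial_invariants0 : lie_irreducible S -> ~ lie_iso S (triv_mod L) ->
  forall s : S, (forall y, lact y s = 0) -> s = 0.
Proof.
move=> [_ irr] niso s ys; apply: contrapT => /eqP s0; apply: niso.
have actc c y : lact y (c *: s) = 0 by rewrite linearZ /= ys scaler0.
have sN x u : u \in <[s]>%VS -> lact x u \in <[s]>%VS.
  by move=> /vlineP[c ->]; rewrite actc mem0v.
have [h|h] := irr (LieSubmodule sN).
  by move: s0; rewrite -[_ == 0]memv0 -[0%VS]h /= memv_line.
have [g gE] : exists g : 'Hom(F^o, S), forall c : F, g c = c *: s.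
  by apply: (@linfunE _ _ _ (fun c : F^o => (c : F) *: s)) => a u v; rewrite scalerDl -scalerA.
have kg : lker g == 0%VS.
  rewrite -subv0; apply/subvP => c; rewrite memv_ker gE scaler_eq0 (negbTE s0) orbF.
  by rewrite memv0.
have surj u : exists c : F, u = c *: s.
  by apply/vlineP; rewrite [<[s]>%VS](h : _ = fullv) memvf.
exists g^-1%VF.
  exists g; last exact: lker0_lfunK.
  by move=> u; have [c ->] := surj u; rewrite -gE lker0_lfunK.
by move=> x u; have [c ->] := surj u; rewrite actc linear0.
Qed.

End Trivial.

Section Ordinary.
Variables (F : fieldType) (p : nat) (hp : p \in [pchar F]).
Variables (L : restrictedLieAlgebra F p) (S : lieModule L).
Hypotheses (irrS : lie_irreducible S) (rS : restricted_module S).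

(** The element x^{p-1} d(x) - d(x^{[p]}) of S is invariant under L, hence 0: it
    is the image of (0, 1) under x^p - x^{[p]} in the extension of F by S that d
    defines, an operator that commutes with L and kills S. *)
Lemma der_restricted : ~ lie_iso S (triv_mod L) ->
  rder_space S = der_space S (0%VS : {vspace L}).
Proof.
move=> niso; have p0 := prime_gt0 (pcharf_prime hp).
apply/eqP; rewrite eqEsubv; apply/andP; split; apply/subvP => d.
  move=> /rder_spaceP[dd _]; apply/der_spaceP; split=> // x.
  by rewrite memv0 => /eqP->; rewrite linear0.
move=> /der_spaceP[dd _]; apply/rder_spaceP; split=> // x.
apply/eqP; rewrite eq_sym -subr_eq0; apply/eqP.
apply: (nontrivial_invariants0 irrS niso) => y.
pose E := ext_mod dd; pose v : E := (0, 1).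
have iterE (u : E) : iter p (@lact F L E x) u =
    (iter p (lact x) u.1 + u.2 *: iter p.-1 (lact x) (d x), 0).
  by have := @ext_iter F p L S d dd p.-1 x u; rewrite (prednK p0).
have i0 : iter p (lact x) 0 = 0 :> S by rewrite -rS linear0.
have := congr1 fst (iter_char_lact x y v hp).
rewrite -rl_pmap_ad lact_br !iterE /= !linear0 i0 !scale0r !scale1r !add0r !addr0 -rS.
move=> h; rewrite linearB /= addrC; apply: (@addrI _ (lact (rl_pmap x) (d y))).
by rewrite addr0 addrA -h.
Qed.

End Ordinary.

Lemma lie_iso_triv (F : fieldType) (L : lieAlgebra F) (S : lieModule L) :
  lie_iso S (triv_mod L) -> (forall x (s : S), lact x s = 0) /\ \dim {:S} = 1%N.
Proof.
move=> iso; split; last by rewrite (lie_iso_dim iso) dimvf.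
move=> x s; have [f bij_f fL] := iso.
by apply: (bij_inj bij_f); rewrite fL linear0.
Qed.

Theorem proposition5p3 (F : fieldType) (p : nat) (hp : p \in [pchar F])
    (L : restrictedLieAlgebra F p) (hL : lie_solvable L)
    (U : restrictedEnvelope L)
    (T : algModule U) (hT : lie_iso (res_mod T) (triv_mod L))
    (P : algModule U) (pi : 'Hom(P, T)) (hP : projective_cover pi)
    (S : lieModule L) (hSirr : lie_irreducible S) (hSres : restricted_module S)
    (n : nat) (N : nat -> lieSubmodule (radical_layer P))
    (hN : composition_series n N)
    (m : nat) (I : nat -> lieIdeal L) (hI : chief_series m I) :
  let W := spanv (range (@rl_pmap F p L)) in
  let D := brv (fullv : {vspace L}) fullv in
  (~ lie_iso S (triv_mod L) ->
     (composition_mult n N S)%:Z = (split_mult m I S)%:Z) /\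
  (lie_iso S (triv_mod L) ->
     (composition_mult n N S)%:Z
     = (split_mult m I S)%:Z - (\dim {: subquotv (D :&: W)%VS W})%:Z).
Proof.
move=> W D; have e0 := end_space_gt0 hSirr.
have pr := pcharf_prime hp.
have derE := dim_derivations hL hSirr hI.
have := dim_rder_space pr hT hP hSirr hSres.
rewrite (dim_hom_space hSirr (@radical_layer_complemented _ _ _ U P) hN) => rderE.
split=> [niso|iso].
  move: rderE; rewrite der_restricted // derE => /addIn/eqP.
  by rewrite eqn_pmul2r // => /eqP->.
have [actS dS] := lie_iso_triv iso.
have inner0 : inner_space S = 0%VS.
  apply/eqP; rewrite -subv0; apply/subvP => d /inner_spaceP[s ds].
  by rewrite memv0; apply/eqP/lfunP => x; rewrite lfunE ds actS.
have end1 : \dim (end_space S) = 1%N.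
  have -> : end_space S = ann_space S 0%VS.
    apply/eqP; rewrite eqEsubv; apply/andP; split; apply/subvP => f.
      by move=> _; apply/ann_spaceP => x; rewrite memv0 => /eqP->; rewrite linear0.
    by move=> _; apply/end_spaceP => x s; rewrite !actS linear0.
  by rewrite dim_ann_space dS dimv0.
have derD : der_space S (0%VS : {vspace L}) = ann_space S D.
  apply/eqP; rewrite eqEsubv; apply/andP; split; apply/subvP => d.
    move=> /der_spaceP[dd _]; apply/ann_spaceP.
    suff /subvP sub : (D <= lker d)%VS by move=> x /sub; rewrite memv_ker => /eqP.
    by apply: brv_sub => x y _ _; rewrite memv_ker dd !actS subrr.
  move=> /ann_spaceP dD; apply/der_spaceP; split=> [x y|x].
    by rewrite !actS subrr dD // brv_mem ?memvf.
  by rewrite memv0 => /eqP->; rewrite linear0.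
have rderDW : rder_space S = ann_space S (D + W)%VS.
  have i0 x (s : S) k : iter k.+1 (lact x) s = 0 by rewrite iterS actS.
  have p1 : p.-1 = p.-2.+1 by rewrite prednK // -ltnS prednK ?prime_gt0 ?prime_gt1.
  apply/eqP; rewrite eqEsubv; apply/andP; split; apply/subvP => d.
    move=> /rder_spaceP[dd rd]; apply/ann_spaceP.
    have /ann_spaceP dD : d \in ann_space S D.
      by rewrite -derD; apply/der_spaceP; split=> // x; rewrite memv0 => /eqP->; rewrite linear0.
    suff /subvP sub : (D + W <= lker d)%VS by move=> x /sub; rewrite memv_ker => /eqP.
    rewrite subv_add; apply/andP; split; first by apply/subvP => x /dD; rewrite memv_ker => ->.
    by apply: spanv_sub => _ [x _ <-]; rewrite memv_ker rd p1 i0.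
  move=> /ann_spaceP dDW; apply/rder_spaceP; split=> [x y|x].
    by rewrite !actS subrr dDW // (subvP (addvSl D W)) // brv_mem ?memvf.
  rewrite p1 i0 dDW // (subvP (addvSr D W)) //.
  by apply: mem_spanv; exists x.
move: rderE derE; rewrite derD rderDW inner0 end1 !dim_ann_space dS !muln1 dimv0 !addn0.
move=> <- <-; rewrite dim_subquotv ?capvSr //.
have sumDW := dimv_sum_cap D W.
have capW : (\dim (D :&: W) <= \dim W)%N by rewrite dimvS ?capvSr.
have sumL : (\dim (D + W) <= \dim {:L})%N by rewrite dimvS ?subvf.
have -> : (\dim {:L} - \dim D = \dim {:L} - \dim (D + W) + (\dim W - \dim (D :&: W)))%N.
  have sE : \dim (D + W) = (\dim D + (\dim W - \dim (D :&: W)))%N.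
    by rewrite addnBA // -sumDW addnK.
  by rewrite sE in sumL *; rewrite subnDA subnK // -(leq_add2l (\dim D)) subnKC // (leq_trans _ sumL) ?leq_addr.
by rewrite PoszD addrK.
Qed.
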